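(* Let $c_0>0$ be a sufficiently large constant, let $1/2<\beta<1$, and suppose $c_0/n\leq p\leq n^{-\beta}$. Then there is $s=s(n)=\frac{2}{2\beta-1}+o(1)$ (as $n\to\infty$) and there are numbers $u,u',u''$ depending on $n$ and $p$ such that with probability $1-o(1)$ as $n\to\infty$, $$u\leq\bar\vartheta_{1/2}(G(n,p))\leq u+s,\quad u'\leq\bar\vartheta(G(n,p))\leq u'+s,\quad u''\leq\bar\vartheta_2(G(n,p))\leq u''+s.$$
   Context: $G(n,p)$ is the random graph on $V=\{1,\dots,n\}$ with each possible edge present independently with probability $p$. For a graph $G=(V,E)$ and a real $k>1$, an $n$-tuple $(v_1,\dots,v_n)$ of unit vectors in $\mathbb R^n$ is a vector $k$-coloring if $\langle v_i,v_j\rangle\leq-1/(k-1)$ for all $\{i,j\}\in E$; strict if $\langle v_i,v_j\rangle=-1/(k-1)$ for all $\{i,j\}\in E$; rigid if moreover (in addition to equality on edges) $\langle v_i,v_j\rangle\geq-1/(k-1)$ for all non-adjacent $i\neq j$. $\bar\vartheta_{1/2}(G)$ (the vector chromatic number), $\bar\vartheta(G)$, $\bar\vartheta_2(G)$ denote the infimum of $k>1$ such that $G$ admits a vector, strict vector, resp. rigid vector $k$-coloring. *)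

(* Defs.v *)
From HB Require Import structures.
From mathcomp Require Import all_boot all_order all_algebra.
From mathcomp Require Import all_classical all_reals all_analysis.
Set Implicit Arguments. Unset Strict Implicit. Unset Printing Implicit Defensive.
Import Order.TTheory GRing.Theory Num.Theory.
Local Open Scope ring_scope.


Definition pairs (n : nat) : {set {set 'I_n}} := [set e : {set 'I_n} | #|e| == 2].

Definition is_graph (n : nat) (E : {set {set 'I_n}}) : bool := E \subset pairs n.

Definition adj (n : nat) (E : {set {set 'I_n}}) (i j : 'I_n) : bool :=
  [set i; j] \in E.

Definition dotv (R : realType) (n : nat) (x y : 'rV[R]_n) : R :=
  \sum_(l < n) x 0 l * y 0 l.

Definition vec_coloring (R : realType) (n : nat) (E : {set {set 'I_n}}) (k : R)
    (v : 'I_n -> 'rV[R]_n) : Prop :=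
  (forall i, dotv (v i) (v i) = 1) /\
  (forall i j, i != j -> adj E i j -> dotv (v i) (v j) <= - (k - 1)^-1).

Definition strict_vec_coloring (R : realType) (n : nat) (E : {set {set 'I_n}}) (k : R)
    (v : 'I_n -> 'rV[R]_n) : Prop :=
  (forall i, dotv (v i) (v i) = 1) /\
  (forall i j, i != j -> adj E i j -> dotv (v i) (v j) = - (k - 1)^-1).

Definition rigid_vec_coloring (R : realType) (n : nat) (E : {set {set 'I_n}}) (k : R)
    (v : 'I_n -> 'rV[R]_n) : Prop :=
  strict_vec_coloring E k v /\
  (forall i j, i != j -> ~~ adj E i j -> - (k - 1)^-1 <= dotv (v i) (v j)).

Definition theta_half (R : realType) (n : nat) (E : {set {set 'I_n}}) : R :=
  inf [set k : R | 1 < k /\ exists v, vec_coloring E k v]%classic.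
Definition theta_bar (R : realType) (n : nat) (E : {set {set 'I_n}}) : R :=
  inf [set k : R | 1 < k /\ exists v, strict_vec_coloring E k v]%classic.
Definition theta_two (R : realType) (n : nat) (E : {set {set 'I_n}}) : R :=
  inf [set k : R | 1 < k /\ exists v, rigid_vec_coloring E k v]%classic.

Definition Gnp_prob (R : realType) (n : nat) (p : R)
    (P : {set {set 'I_n}} -> Prop) : R :=
  \sum_(E : {set {set 'I_n}} | is_graph E && `[< P E >])
     p ^+ #|E| * (1 - p) ^+ (#|pairs n| - #|E|).

Arguments theta_half {R n} E.
Arguments theta_bar {R n} E.
Arguments theta_two {R n} E.

(* Main.v *)
(** Efron-Stein and Chebyshev: if [u] is a quantile of the parameter at a small
    level, then with high probability deleting a set [U] of at most
    [n^(1/2 + g)] vertices leaves a graph with a vector [(u + 1)]-coloring.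
    All sets of at most [2 n^(1/2 + g)] vertices span fewer than [r] edges per
    vertex, so after adding to [U] the vertices with many neighbors in it,
    every outside vertex has fewer than [2 r] neighbors in [U], while [U] and
    all neighborhoods are [2 r]-colorable.

    Write a vector [k]-coloring as vectors [z_i = h + y_i] with a unit handle
    [h], [h] orthogonal to [y_i], [|z_i|^2 = k], and [z_i], [z_j] orthogonal for
    adjacent [i], [j].  A deleted vertex [u] with an independent neighborhood is
    reinserted as [z_u = h + rho g_u] with a new unit direction [g_u], replacing
    [z_w] by [z_w - g_u / rho] for the neighbors [w] of [u]; this raises [k] by
    [1 / rho^2] only, and [rho^2] may be as large as [k - 1].  With [2 r]-colorings
    of [U] and of the neighborhoods the same works simultaneously for all of
    [U], at the cost [(2 r)^2 / (k - 2 r)].  This is at most [1] once [k] is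
    large, so the parameter lies in [[u, u + 2]], and [2 < 2 / (2 beta - 1)].

    The parameters exceed any constant [K] when [n p] exceeds some [C(K)]:
    random signs round a vector coloring to a cut, and a union bound over all
    cuts applies.  If [n p] is below the constant needed for the [r] belonging
    to [beta], then [r = 2] suffices, and this case fixes [c0]. *)

Require Import Defs.
From HB Require Import structures.
From mathcomp Require Import all_boot all_order all_algebra.
From mathcomp Require Import all_classical all_reals all_analysis.
From mathcomp Require Import fintype finset ring lra zify.
Set Implicit Arguments. Unset Strict Implicit. Unset Printing Implicit Defensive.
Import Order.TTheory GRing.Theory Num.Theory.
Import numFieldNormedType.Exports.
Local Open Scope ring_scope.

(** * Random subsets with independent elements *)

Section BernoulliSubset.
Variables (R : realType) (T : finType) (A : {set T}) (p : R).
Implicit Types (E F : {set T}) (f g : {set T} -> R).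

Definition bern_weight E : R := p ^+ #|E| * (1 - p) ^+ (#|A| - #|E|).

Definition expect f : R := \sum_(E : {set T} | E \subset A) bern_weight E * f E.

Lemma eq_expect f g : (forall E, E \subset A -> f E = g E) -> expect f = expect g.
Proof. by move=> fg; apply: eq_bigr => E EA; rewrite fg. Qed.

Lemma expectD f g : expect (fun E => f E + g E) = expect f + expect g.
Proof. by rewrite /expect -big_split /=; apply: eq_bigr => E _; rewrite mulrDr. Qed.

Lemma expectZ c f : expect (fun E => c * f E) = c * expect f.
Proof. by rewrite /expect mulr_sumr; apply: eq_bigr => E _; rewrite mulrCA. Qed.

Lemma expect_sum (I : Type) (r : seq I) (P : pred I) (f : I -> {set T} -> R) :
  expect (fun E => \sum_(i <- r | P i) f i E) = \sum_(i <- r | P i) expect (f i).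
Proof.
rewrite /expect exchange_big /=; apply: eq_bigr => E _.
by rewrite mulr_sumr.
Qed.

(** Independence: distributing the product over all elements leaves one term per set of present
    elements. An element outside [A] gets factor 0 if present and 1 if absent, which kills the sets
    not contained in [A]. *)
Lemma expect_prod (g : T -> bool -> R) :
  expect (fun E => \prod_(e in A) g e (e \in E)) =
  \prod_(e in A) (p * g e true + (1 - p) * g e false).
Proof.
rewrite [RHS]big_mkcond /=.
rewrite (eq_bigr (fun e => (if e \in A then p * g e true else 0) +
           (if e \in A then (1 - p) * g e false else 1))); last first.
  by move=> e _; case: ifP => //; rewrite add0r.
rewrite (@bigA_distr R 0 1 *%R +%R) (bigID (fun E => E \subset A)) /= [X in _ + X]big1 ?addr0; last first.
  move=> E /subsetPn[e eE eA].
  by rewrite (bigD1 e) //= eE (negbTE eA) mul0r.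
apply: eq_bigr => E EA.
rewrite [RHS](bigID (mem A)) /= [X in _ = _ * X]big1 ?mulr1; last first.
  move=> e eA; rewrite (negbTE eA); case: (boolP (e \in E)) => // eE.
  by rewrite (subsetP EA) // in eA.
rewrite [in RHS](eq_bigr (fun e => (if e \in E then p else 1 - p) * g e (e \in E))); last first.
  by move=> e ->; case: ifP.
rewrite big_split /=; congr (_ * _).
rewrite (bigID (mem E)) /= /bern_weight.
rewrite (eq_bigr (fun=> p)); last by move=> e /andP[_ ->].
rewrite [X in _ = _ * X](eq_bigr (fun=> 1 - p)); last by move=> e /andP[_ /negbTE ->].
rewrite !prodr_const; congr (_ ^+ _ * _ ^+ _).
  by apply: eq_card => e; rewrite [RHS]unfold_in /= andb_idl //; apply: (subsetP EA).
rewrite -(cardsID E A) (setIidPr EA) addKn.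
by apply: eq_card => e; rewrite [RHS]unfold_in /= !inE andbC.
Qed.

Lemma expect_cst c : expect (fun=> c) = c.
Proof.
have -> : expect (fun=> c) = c * expect (fun E => \prod_(e in A) 1).
  by rewrite -expectZ; apply: eq_expect => E _; rewrite big1 ?mulr1.
rewrite (expect_prod (fun _ _ => 1)) big1 ?mulr1 // => e _; lra.
Qed.

Lemma expect_sub F : F \subset A ->
  expect (fun E => (F \subset E)%:R) = p ^+ #|F|.
Proof.
move=> FA.
rewrite (@eq_expect _ (fun E => \prod_(e in A) (if e \in F then (e \in E)%:R else 1))).
  rewrite (expect_prod (fun e b => if e \in F then b%:R else 1)).
  rewrite (bigID (mem F)) /= [X in _ * X]big1 ?mulr1; last first.
    by move=> e /andP[_ /negbTE ->]; lra.
  rewrite (eq_bigr (fun=> p)); last by move=> e /andP[_ ->]; lra.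
  rewrite prodr_const; congr (_ ^+ _); apply: eq_card => e.
  by rewrite [LHS]unfold_in /= andb_idl //; apply: (subsetP FA).
move=> E EA; case: (boolP (F \subset E)) => [FE|/subsetPn[e eF eE]].
  by rewrite big1 // => e _; case: ifP => // /(subsetP FE) ->.
by rewrite (bigD1 e) ?(subsetP FA) //= eF (negbTE eE) mul0r.
Qed.

(** The conditional expectation of [f] given everything except the membership of [e]. *)
Definition resample e f E : R := p * f (e |: E) + (1 - p) * f (E :\ e).

Lemma expect_split e f : e \in A ->
  expect f = \sum_(E : {set T} | E \subset A :\ e)
    p ^+ #|E| * (1 - p) ^+ (#|A :\ e| - #|E|) * resample e f E.
Proof.
move=> eA; rewrite /expect (bigID (fun E => e \in E)) /=.
rewrite (reindex_onto (fun E => e |: E) (fun E => E :\ e)) /=; last first.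
  by move=> E /andP[_ eE]; rewrite setD1K.
rewrite (eq_bigl (fun E => E \subset A :\ e)); last first.
  move=> E; rewrite setU11 andbT subsetD1.
  rewrite subUset sub1set eA /=; case: (boolP (e \in E)) => eE; rewrite ?andbT ?andbF //=.
    by apply/negbTE/negP => /andP[_ /eqP/setP/(_ e)]; rewrite !inE eqxx eE.
  by rewrite setU1K // eqxx andbT.
rewrite [X in _ + X](eq_bigl (fun E => E \subset A :\ e)); last first.
  by move=> E; rewrite subsetD1.
rewrite -big_split /=; apply: eq_bigr => E; rewrite subsetD1 => /andP[EA eE].
have := cardsD1 e A; rewrite eA /= => cA.
have lEA : (#|E| <= #|A :\ e|)%N by apply: subset_leq_card; rewrite subsetD1 EA eE.
rewrite /bern_weight /resample cardsU1 eE cA !add1n subSS subSn // !exprS.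
have -> : E :\ e = E by apply/setDidPl; rewrite disjoint_sym disjoints1.
ring.
Qed.

Lemma resampleU e f E : resample e f (e |: E) = resample e f E.
Proof. by rewrite /resample setUA setUid setDUl setDv set0U. Qed.

Lemma resampleD e f E : resample e f (E :\ e) = resample e f E.
Proof. by rewrite /resample setDDl setUid; congr (_ * f _ + _); apply/setP=> x; rewrite !inE; case: eqP. Qed.

Lemma expect_resample e f : e \in A -> expect (resample e f) = expect f.
Proof.
move=> eA; rewrite !(expect_split _ eA); apply: eq_bigr => E _.
rewrite {1}/resample resampleU resampleD; congr (_ * _); ring.
Qed.

Section Positive.
Hypothesis p01 : 0 <= p <= 1.

Lemma bern_weight_ge0 E : 0 <= bern_weight E.
Proof.
by case/andP: p01 => p0 p1; rewrite mulr_ge0 ?exprn_ge0 ?subr_ge0.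
Qed.

Lemma ler_expect f g : (forall E, E \subset A -> f E <= g E) ->
  expect f <= expect g.
Proof. by move=> fg; apply: ler_sum => E EA; rewrite ler_wpM2l ?bern_weight_ge0 ?fg. Qed.

Lemma ler_resample e f g E :
  f (e |: E) <= g (e |: E) -> f (E :\ e) <= g (E :\ e) -> resample e f E <= resample e g E.
Proof. by case/andP: p01 => p0 p1 fg1 fg2; rewrite lerD ?ler_wpM2l ?subr_ge0. Qed.

End Positive.
End BernoulliSubset.

(** * Averaging over blocks of elements and the Efron-Stein inequality *)

Section Averaging.
Variables (R : realType) (T : finType) (p : R).
Hypothesis p01 : 0 <= p <= 1.
Implicit Types (E F B C : {set T}) (f g : {set T} -> R) (s : seq T).

Definition average s f : {set T} -> R := foldr (resample p) f s.

(** The condition is symmetric in [E] and [F], so it bounds the absolute difference. *)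
Definition lipschitz_on B f := forall E F, E :\: B = F :\: B -> f E <= f F + 1.

Definition invariant_off C f := forall E F, E :\: C = F :\: C -> f E = f F.

Lemma setDU1_in e E B : e \in B -> (e |: E) :\: B = E :\: B.
Proof.
move=> eB; apply/setP=> x; rewrite !inE.
by case: eqP => [->|//]; rewrite eB.
Qed.

Lemma setDD1_in e E B : e \in B -> (E :\ e) :\: B = E :\: B.
Proof.
move=> eB; apply/setP=> x; rewrite !inE.
by case: eqP => [->|//]; rewrite eB.
Qed.

Lemma averageD s f g E :
  average s (fun F => f F + g F) E = average s f E + average s g E.
Proof.
elim: s E => //= e s IH E; rewrite /resample !IH; ring.
Qed.

Lemma averageZ s c f E : average s (fun F => c * f F) E = c * average s f E.
Proof. elim: s E => //= e s IH E; rewrite /resample !IH; ring. Qed.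

Lemma average_cst s c E : average s (fun=> c) E = c.
Proof. elim: s E => //= e s IH E; rewrite /resample !IH; ring. Qed.

Lemma ler_average s f g B E : {subset s <= B} ->
  (forall F, F :\: B = E :\: B -> f F <= g F) -> average s f E <= average s g E.
Proof.
elim: s E => [|e s IH] E sB fg /=; first exact: fg.
have eB : e \in B by apply: sB; rewrite mem_head.
have sB' : {subset s <= B} by move=> x xs; apply: sB; rewrite inE xs orbT.
apply: ler_resample => //; apply: IH => // F FE; apply: fg; rewrite FE.
  exact: setDU1_in.
exact: setDD1_in.
Qed.

(** A conditional variance of at most 1: averaging [(f F - c) ^+ 2 <= 1] with the fixed reference
    [c = f E] bounds the second moment, and the remainder [- (average s f E - c) ^+ 2] has the right
    sign. *)
Lemma average_sqr s B f E : {subset s <= B} -> lipschitz_on B f ->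
  average s (fun F => f F ^+ 2) E <= average s f E ^+ 2 + 1.
Proof.
move=> sB fB; set c := f E.
have H : average s (fun F => f F ^+ 2 + (- (2 * c)) * f F) E
         <= average s (fun F => 1 - c ^+ 2) E.
  apply: (ler_average sB) => F FE.
  have h1 := fB _ _ FE; have h2 := fB _ _ (esym FE).
  rewrite -/c in h1 h2; nra.
rewrite averageD averageZ average_cst in H.
have := sqr_ge0 (average s f E - c); nra.
Qed.

(** Averaging one block must not spoil the others. Resampling treats [E] and [F] alike, so they
    still agree off [B]. *)
Lemma resample_lipschitz e B f : lipschitz_on B f -> lipschitz_on B (resample p e f).
Proof.
move=> fB E F EF; rewrite /resample.
have h1 : f (e |: E) <= f (e |: F) + 1 by apply: fB; rewrite !setDUl EF.
have h2 : f (E :\ e) <= f (F :\ e) + 1.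
  by apply: fB; rewrite !setDDl ![[set e] :|: _]setUC -!setDDl EF.
case/andP: p01 => p0 p1; nra.
Qed.

Lemma average_lipschitz s B f : lipschitz_on B f -> lipschitz_on B (average s f).
Proof. by move=> fB; elim: s => //= e s IH; apply: resample_lipschitz. Qed.

Lemma average_invariant s C f : invariant_off C f ->
  invariant_off ([set e in s] :|: C) (average s f).
Proof.
move=> fC; elim: s => [|e s IH] E F /=.
  by rewrite set_nil set0U; apply: fC.
move=> EF; have {}EF : (E :\: ([set e in s] :|: C)) :\ e = (F :\: ([set e in s] :|: C)) :\ e.
  apply/setP=> x; move/setP/(_ x): EF; rewrite !inE.
  by case: eqP.
rewrite /resample; congr (_ * _ + _ * _); apply: IH.
  apply/setP=> x; move/setP/(_ x): EF; rewrite !inE.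
  by case: eqP.
apply/setP=> x; move/setP/(_ x): EF; rewrite !inE.
by case: eqP; rewrite ?andbF.
Qed.

Definition averages (bs : seq (seq T)) f := foldl (fun g b => average b g) f bs.

Lemma averages_invariant bs C f : invariant_off C f ->
  invariant_off ([set e in flatten bs] :|: C) (averages bs f).
Proof.
elim: bs f C => [|b bs IH] f C fC /=; first by rewrite set_nil set0U.
have -> : [set e in b ++ flatten bs] :|: C = [set e in flatten bs] :|: ([set e in b] :|: C).
  by apply/setP => x; rewrite !inE mem_cat; case: (x \in b); rewrite ?orbT.
exact/IH/average_invariant.
Qed.

Variable A : {set T}.

Lemma expect_average s f : {subset s <= A} -> expect A p (average s f) = expect A p f.
Proof.
elim: s => //= e s IH sA; rewrite expect_resample ?sA ?mem_head // IH // => x xs.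
by rewrite sA // inE xs orbT.
Qed.

Lemma expect_averages bs f : {subset flatten bs <= A} ->
  expect A p (averages bs f) = expect A p f.
Proof.
elim: bs f => //= b bs IH f bA; rewrite IH ?expect_average // => x xb;
by apply: bA; rewrite mem_cat xb ?orbT.
Qed.

(** Induction on the blocks: [average_sqr] pays 1 for the first block, and the averaged function
    stays Lipschitz on the others. *)
Lemma expect_sqr_averages bs f : {subset flatten bs <= A} ->
  (forall b, b \in bs -> lipschitz_on [set e in b] f) ->
  expect A p (fun E => f E ^+ 2) <=
  expect A p (fun E => averages bs f E ^+ 2) + (size bs)%:R.
Proof.
elim: bs f => [|b bs IH] f bA fL /=; first by rewrite addr0.
have bA1 : {subset b <= A} by move=> x xb; apply: bA; rewrite mem_cat xb.
rewrite -(expect_average _ bA1).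
apply: (@le_trans _ _ (expect A p (fun E => average b f E ^+ 2 + 1))).
  apply: ler_expect => // E _; apply: (@average_sqr _ [set e in b]).
    by move=> x; rewrite inE.
  by apply: fL; rewrite mem_head.
rewrite expectD expect_cst -natr1 addrA lerD2r; apply: IH.
  by move=> x xb; apply: bA; rewrite mem_cat xb orbT.
by move=> b' bb; apply/average_lipschitz/fL; rewrite inE bb orbT.
Qed.

(* Efron-Stein: resampling block after block, each one costs at most 1. *)
Lemma expect_sqr_le (I : finType) (B : I -> {set T}) f :
  (forall i, B i \subset A) -> (forall e, e \in A -> exists i, e \in B i) ->
  (forall i, lipschitz_on (B i) f) ->
  expect A p (fun E => f E ^+ 2) <= expect A p f ^+ 2 + #|I|%:R.
Proof.
move=> BA AB fL; pose bs := [seq enum (B i) | i <- enum I].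
have bsA : {subset flatten bs <= A}.
  move=> x /flatten_mapP[i _]; rewrite mem_enum; exact: (subsetP (BA i)).
have sbs : size bs = #|I| by rewrite size_map -cardE.
have bsL b : b \in bs -> lipschitz_on [set e in b] f.
  case/mapP=> i _ ->; suff -> : [set e in enum (B i)] = B i by apply: fL.
  by apply/setP=> x; rewrite inE mem_enum.
have := expect_sqr_averages bsA bsL; rewrite sbs => /le_trans; apply.
rewrite lerD2r.
have inv : invariant_off ([set e in flatten bs] :|: set0) (averages bs f).
  by apply: averages_invariant => E F; rewrite !setD0 => ->.
(* With every element of [A] averaged out the function is constant on subsets of [A], so the mean of
   its square is the square of its mean. *)
have Ecst E : E \subset A -> averages bs f E = averages bs f set0.
  move=> EA; apply: inv; rewrite setU0 set0D; apply/eqP; rewrite setD_eq0.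
  apply/subsetP => x /(subsetP EA)/AB[i xi]; rewrite inE.
  by apply/flatten_mapP; exists i; rewrite ?mem_enum.
rewrite -[in leRHS](expect_averages f bsA).
rewrite (eq_expect _ (g := fun=> averages bs f set0 ^+ 2)); last by move=> E /Ecst ->.
by rewrite (eq_expect _ Ecst) !expect_cst.
Qed.

End Averaging.

(** * Probabilities, quantiles and tails of Lipschitz functions *)

Section Probability.
Variables (R : realType) (T : finType) (A : {set T}) (p : R).
Hypothesis p01 : 0 <= p <= 1.
Implicit Types (E F : {set T}) (f g : {set T} -> R) (Q : {set T} -> Prop).

Definition prob Q : R := expect A p (fun E => (`[< Q E >])%:R).

Lemma prob_le1 Q : prob Q <= 1.
Proof. by rewrite -[leRHS](expect_cst A p); apply: ler_expect => // E _; case: asboolP. Qed.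

Lemma ler_prob Q1 Q2 : (forall E, E \subset A -> Q1 E -> Q2 E) -> prob Q1 <= prob Q2.
Proof.
move=> Q12; apply: ler_expect => // E EA.
by case: (asboolP (Q1 E)) => [/(Q12 _ EA)/asboolT ->|].
Qed.

Lemma prob_not Q : prob (fun E => ~ Q E) = 1 - prob Q.
Proof.
apply/eqP; rewrite -subr_eq0 opprB addrA subr_eq0 -expectD.
rewrite -[eqbRHS](expect_cst A p); apply/eqP/eq_expect => E _.
by rewrite asbool_neg; case: asboolP; rewrite ?add0r ?addr0.
Qed.

Lemma prob_or Q1 Q2 : prob (fun E => Q1 E \/ Q2 E) <= prob Q1 + prob Q2.
Proof.
rewrite -expectD; apply: ler_expect => // E _.
by rewrite asbool_or; case: asboolP; case: asboolP => /=; lra.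
Qed.

Lemma markov_prob Q f : (forall E, E \subset A -> 0 <= f E) ->
  (forall E, E \subset A -> Q E -> 1 <= f E) -> prob Q <= expect A p f.
Proof.
move=> f0 f1; apply: ler_expect => // E EA.
by case: asboolP => [/f1 ->|_]; rewrite ?f0.
Qed.

Lemma prob_exists_le (I : finType) (P : pred I) (Q : I -> {set T} -> Prop) :
  prob (fun E => exists2 i, P i & Q i E) <= \sum_(i | P i) prob (Q i).
Proof.
rewrite -expect_sum; apply: ler_expect => // E _.
case: asboolP => [[i Pi Qi]|_]; last by rewrite sumr_ge0.
by rewrite (bigD1 i) //= asboolT // lerDl sumr_ge0.
Qed.

Lemma prob_sub F : F \subset A -> prob (fun E => F \subset E) = p ^+ #|F|.
Proof.
by move=> FA; rewrite -(expect_sub p FA); apply: eq_expect => E _; rewrite asboolb.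
Qed.

(** [u] is the least attained value at which the distribution function reaches [eps]. Either no
    value is smaller, or [theta E < u] means being at most the next smaller value, where [eps] is
    not yet reached. *)
Lemma expect_quantile (theta : {set T} -> R) (eps : R) : 0 <= eps <= 1 ->
  exists u, eps <= prob (fun E => theta E <= u) /\ prob (fun E => theta E < u) <= eps.
Proof.
move=> /andP[eps0 eps1].
pose P E := eps <= prob (fun F => theta F <= theta E).
have [F0 _ F0max] : exists2 F0, true & forall F, theta F <= theta F0.
  exists [arg max_(F > (finset.set0 : {set T}) | true) theta F]%O => //.
  by case: arg_maxP => // F _ FM G; apply: FM.
have PF0 : P F0.
  rewrite /P (_ : prob _ = 1) // -[RHS](expect_cst A p).
  by apply: eq_expect => E _; rewrite asboolb F0max.
case: (arg_minP theta PF0) => F1 PF1 F1min; exists (theta F1); split => //.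
have [/existsP[G0 G01]|/existsPn noG] := boolP [exists G, theta G < theta F1]; last first.
  apply: le_trans eps0; rewrite -(expect_cst A p 0); apply: ler_expect => // E _.
  by rewrite asboolb (negbTE (noG E)).
case: (@arg_maxP _ _ _ G0 (fun G => theta G < theta F1) theta G01) => G1 G11 G1max.
have : ~~ P G1 by apply/negP => /F1min; rewrite leNgt G11.
rewrite /P -ltNge => /ltW; apply: le_trans.
by apply: ler_prob => E _ /G1max.
Qed.

(** Chebyshev twice, with variance at most [#|I|]: the value 0 is too likely for the mean to exceed
    [lam / 2], so a value above [lam] deviates by at least [lam / 2]. *)
Lemma lipschitz_tail (I : finType) (B : I -> {set T}) f (lam : R) :
  (forall i, B i \subset A) -> (forall e, e \in A -> exists i, e \in B i) ->
  (forall i, lipschitz_on (B i) f) -> (forall E, 0 <= f E) ->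
  0 < lam -> (0 < #|I|)%N ->
  4 * #|I|%:R / lam ^+ 2 <= prob (fun E => f E = 0) ->
  prob (fun E => lam < f E) <= 4 * #|I|%:R / lam ^+ 2.
Proof.
move=> BA AB fL f0 lam0 I0 f00; set mu := expect A p f.
have I0' : 0 < #|I|%:R :> R by rewrite ltr0n.
have var : expect A p (fun E => (f E - mu) ^+ 2) <= #|I|%:R.
  rewrite (eq_expect _ (g := fun E => f E ^+ 2 + ((- (2 * mu)) * f E + mu ^+ 2))); last first.
    by move=> E _; ring.
  rewrite !expectD expectZ expect_cst -/mu.
  have := expect_sqr_le p01 BA AB fL; rewrite -/mu; nra.
have mu0 : 0 <= mu by rewrite -(expect_cst A p 0); apply: ler_expect.
have cheb Q c : (forall E, Q E -> c <= (f E - mu) ^+ 2) -> prob Q * c <= #|I|%:R.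
  move=> Qc; apply: le_trans var; rewrite mulrC -expectZ; apply: ler_expect => // E _.
  by case: asboolP => [/Qc|_]; rewrite ?mulr1 ?mulr0 ?sqr_ge0.
have l2 : 0 < lam ^+ 2 by rewrite exprn_gt0.
have mul : mu <= lam / 2.
  rewrite leNgt; apply/negP => ltmu.
  have /(cheb (fun E => f E = 0) (mu ^+ 2)) : forall E, f E = 0 -> mu ^+ 2 <= (f E - mu) ^+ 2.
    by move=> E ->; rewrite add0r sqrrN.
  have h : 4 * #|I|%:R <= prob (fun E => f E = 0) * lam ^+ 2 by rewrite -ler_pdivrMr.
  have : lam ^+ 2 / 4 < mu ^+ 2 by nra.
  have : 0 < prob (fun E => f E = 0).
    by apply: lt_le_trans f00; rewrite divr_gt0 // mulr_gt0.
  nra.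
rewrite ler_pdivlMr //.
have /(cheb (fun E => lam < f E) (lam ^+ 2 / 4)) : 
    forall E, lam < f E -> lam ^+ 2 / 4 <= (f E - mu) ^+ 2 by move=> E ?; nra.
lra.
Qed.

End Probability.

(** * Sparse graphs *)

Section Sparse.
Variables (R : realType) (n : nat).
Implicit Types (E : {set {set 'I_n}}) (S U X : {set 'I_n}) (i j v w : 'I_n).

Lemma in_pairs i j : ([set i; j] \in pairs n) = (i != j).
Proof. by rewrite inE cards2; case: (i != j). Qed.

Lemma sum_pairs (F : {set 'I_n} -> R) :
  \sum_i \sum_(j | j != i) F [set i; j] = 2 * \sum_(e in pairs n) F e.
Proof.
rewrite mulr_sumr.
transitivity (\sum_(e in pairs n) \sum_(i in e) F e); last first.
  apply: eq_bigr => e; rewrite inE => /eqP e2.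
  by rewrite sumr_const e2 mulr_natl.
rewrite [RHS](exchange_big_dep predT) //=; apply: eq_bigr => i _.
rewrite [RHS](reindex_onto (fun j => [set i; j]) (fun e => odflt i [pick j in e :\ i])) /=.
  apply: eq_bigl => j; rewrite in_pairs set21 andbT eq_sym.
  have [ij|] //= := boolP (i != j).
  case: pickP => [k|/(_ j)] /=; rewrite !inE; last by rewrite eq_sym ij eqxx orbT.
  by case/andP=> /negbTE -> /=.
move=> e /andP[]; rewrite inE => e2 ie.
case: pickP => [k|ei0] /=.
  rewrite !inE => /andP[ki ke]; apply/eqP; rewrite eqEcard (eqP e2) cards2 eq_sym ki andbT.
  by apply/subsetP => x; rewrite !inE => /orP[] /eqP ->.
have := cardsD1 i e; rewrite (eqP e2) ie.
have -> : e :\ i = set0 by apply/setP => x; rewrite ei0 inE.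
by rewrite cards0.
Qed.

Definition inner_edges E S := [set e in E | e \subset S].

Definition nbrs E v := [set w | (w != v) && adj E v w].

Definition sparse E (r : nat) (lam : R) : Prop := forall S, S != set0 ->
  #|S|%:R <= lam -> (#|inner_edges E S| < r * #|S|)%N.

Lemma adjC E i j : adj E i j = adj E j i.
Proof. by rewrite /adj setUC. Qed.

Lemma handshake E S : is_graph E ->
  (\sum_(v in S) #|nbrs E v :&: S| = 2 * #|inner_edges E S|)%N.
Proof.
move=> gE; apply: (@mulrIn R 1 _); first exact: oner_neq0.
have := sum_pairs (fun e => (e \in inner_edges E S)%:R).
have -> : \sum_(e in pairs n) (e \in inner_edges E S)%:R = #|inner_edges E S|%:R :> R.
  rewrite -sum1_card natr_sum big_mkcond [RHS]big_mkcond /=; apply: eq_bigr => e _.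
  case: ifP => eP; first by case: ifP.
  rewrite ifF // inE; apply/negbTE/negP => /andP[/(subsetP gE)].
  by rewrite eP.
rewrite -natrM => <-; rewrite natr_sum [LHS]big_mkcond; apply: eq_bigr => v _.
case: ifP => vS; last first.
  by rewrite big1 // => w _; rewrite inE subUset sub1set vS andbF.
rewrite -sum1_card natr_sum big_mkcond [RHS]big_mkcond; apply: eq_bigr => w _.
rewrite !inE subUset !sub1set vS /= /adj.
by case: (w != v) => //=; case: (_ \in E); case: (w \in S).
Qed.

(** By the handshake identity the average degree inside [S] is below [2 * r]. *)
Lemma sparse_vertex E r lam S : is_graph E -> sparse E r lam -> S != set0 ->
  #|S|%:R <= lam -> exists2 v, v \in S & (#|nbrs E v :&: S| < 2 * r)%N.
Proof.
move=> gE sE S0 Sl; have := sE _ S0 Sl.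
have [/existsP[v /andP[vS vr] _]|/existsPn H] :=
    boolP [exists v, (v \in S) && (#|nbrs E v :&: S| < 2 * r)%N]; first by exists v.
rewrite ltnNge -(leq_pmul2l (isT : 0 < 2)%N) -handshake // => /negP[].
rewrite mulnA -[X in (_ <= X)%N]/(\sum_(v in S) _)%N mulnC -sum_nat_const.
apply: leq_sum => v vS; have := H v; by rewrite vS /= -leqNgt.
Qed.

Definition proper_coloring E S (m : nat) (c : 'I_n -> 'I_m) : Prop :=
  forall i j, i \in S -> j \in S -> i != j -> adj E i j -> c i != c j.

(** Greedy coloring: remove a vertex of small degree, color the rest, and give the vertex a color
    missing among its fewer than [m] neighbors. *)
Lemma degenerate_coloring E S m : (0 < m)%N ->
  (forall X, X \subset S -> X != set0 -> exists2 v, v \in X & (#|nbrs E v :&: X| < m)%N) ->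
  exists c : 'I_n -> 'I_m, proper_coloring E S c.
Proof.
move=> m0; elim: {S}_.+1 {-2}S (ltnSn #|S|) => // k IH S Sk dS.
have [->|S0] := eqVneq S set0.
  by exists (fun=> Ordinal m0) => i j; rewrite inE.
have [v vS vm] := dS _ (subxx S) S0.
have [|X XS|c cP] := IH (S :\ v).
- by have := cardsD1 v S; rewrite vS; lia.
- by apply: dS; apply: (subset_trans XS); rewrite subsetDl.
have [a ac] : exists a, a \notin c @: (nbrs E v :&: S).
  apply/existsP; rewrite -negb_forall; apply/negP => /forallP H.
  have : (#|'I_m| <= #|c @: (nbrs E v :&: S)|)%N.
    by rewrite -cardsT; apply/subset_leq_card/subsetP => x _.
  by rewrite card_ord leqNgt (leq_ltn_trans (leq_imset_card _ _) vm).
exists (fun i => if i == v then a else c i) => i j iS jS ij aij.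
have [iv|iv] := eqVneq i v; have [jv|jv] := eqVneq j v.
- by rewrite iv jv eqxx in ij.
- apply: contra ac => /eqP ->; apply: imset_f.
  by rewrite !inE jv -iv aij.
- apply: contra ac => /eqP <-; apply: imset_f.
  by rewrite !inE iv -jv adjC aij.
- by apply: cP => //; rewrite !inE ?iv ?jv.
Qed.

Lemma sparse_coloring E r lam S : is_graph E -> (0 < r)%N -> sparse E r lam ->
  #|S|%:R <= lam -> exists c : 'I_n -> 'I_(2 * r), proper_coloring E S c.
Proof.
move=> gE r0 sE Sl; apply: degenerate_coloring; first by rewrite muln_gt0.
move=> X XS X0; apply: (sparse_vertex gE sE) => //.
by apply: le_trans Sl; rewrite ler_nat subset_leq_card.
Qed.

(* Adding vertices with [2 * r] neighbours in the current set cannot go on for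
   long, because it would create a dense set of at most [2 * lam] vertices. *)
Lemma sparse_closure E r lam U : is_graph E -> (0 < r)%N -> 1 <= lam ->
  sparse E r (2 * lam) -> #|U|%:R <= lam ->
  exists X, [/\ U \subset X, #|X|%:R <= 2 * lam &
    forall w, w \notin X -> (#|nbrs E w :&: X| < 2 * r)%N].
Proof.
move=> gE r0 lam1 sE Ul.
(* The last clause records that each vertex added to [U] brought [2 * r] new edges. A set maximal
   for [P] is taken. *)
pose P X := [&& U \subset X, #|X|%:R <= 2 * lam &
  (2 * r * (#|X| - #|U|) <= #|inner_edges E X|)%N].
have PU : P U by rewrite /P subxx subnn muln0 leq0n andbT /=; lra.
case: (@arg_maxnP _ U P (fun X => #|X|) PU) => X /and3P[UX X2 Xe] Xmax.
exists X; split => // w wX; rewrite ltnNge; apply/negP => wr.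
have cwX : #|w |: X| = #|X|.+1 by rewrite cardsU1 wX.
have star : (#|nbrs E w :&: X| + #|inner_edges E X| <= #|inner_edges E (w |: X)|)%N.
  have <- : #|[set [set w; v] | v in nbrs E w :&: X]| = #|nbrs E w :&: X|.
    apply: card_in_imset => v1 v2; rewrite !inE => /andP[/andP[v1w _] _] _ /setP/(_ v1).
    by rewrite !inE eqxx orbT (negbTE v1w) /= => /esym/eqP.
  have iX : inner_edges E X \subset inner_edges E (w |: X).
    apply/subsetP => e; rewrite !inE => /andP[-> eX].
    exact: subset_trans eX (subsetUr _ _).
  rewrite addnC -leq_subRL ?subset_leq_card //.
  apply: leq_trans (_ : #|inner_edges E (w |: X) :\: inner_edges E X| <= _)%N.
    apply/subset_leq_card/subsetP => e /imsetP[v]; rewrite !inE => /andP[/andP[vw avw] vX] ->.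
    rewrite !subUset !sub1set !inE eqxx vX orbT (negbTE wX) /= andbF /=.
    by rewrite [_ \in E]avw.
  by rewrite cardsD (setIidPr iX).
have ce : (2 * r * (#|w |: X| - #|U|) <= #|inner_edges E (w |: X)|)%N.
  rewrite cwX subSn ?subset_leq_card // mulnS.
  by apply: leq_trans star; rewrite leq_add.
have [wX2|wX2] := leP (#|w |: X|%:R) (2 * lam).
  have : (#|w |: X| <= #|X|)%N.
    apply: Xmax; rewrite /P wX2 ce andbT (subset_trans UX) //; exact: subsetUr.
  by rewrite cwX ltnn.
(* Only the size bound can block the growth, so [X] is within 1 of [2 * lam]. By integrality
   [2 * #|U| <= #|X|], and the recorded edges number at least [r * #|X|]. *)
have Xgt : 2 * lam - 1 < #|X|%:R by move: wX2; rewrite cwX -natr1; lra.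
have X0 : X != set0 by rewrite -card_gt0 -(ltr0n R); lra.
have := sE _ X0 X2; rewrite ltnNge => /negP; apply; apply: leq_trans Xe.
have UXc : (#|U| <= #|X|)%N by apply: subset_leq_card.
have : (2 * #|U| <= #|X|)%N.
  rewrite -ltnS -(ltr_nat R) -natr1 natrM; lra.
nia.
Qed.

End Sparse.

(** * Vector colorings *)

Section GramMatrices.
Variable R : realType.

Definition dotf (I : finType) (x y : I -> R) : R := \sum_l x l * y l.

(** Cholesky factorization: the Schur complement of the corner entry is again positive
    semidefinite. *)
Lemma psd_factor n (M : 'M[R]_n) : M^T = M ->
  (forall x : 'rV_n, 0 <= (x *m M *m x^T) 0 0) -> exists Y : 'M[R]_n, M = Y *m Y^T.
Proof.
elim: n M => [|n IH] M Msym Mpsd.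
  by exists 0; apply/matrixP => -[].
rewrite -[n.+1]/(1 + n)%N in M Msym Mpsd *.
pose a := M 0 0; pose b := @ursubmx R 1 n 1 n M.
pose C := @drsubmx R 1 n 1 n M.
have ulE : @ulsubmx R 1 n 1 n M = a%:M.
  by rewrite [LHS]mx11_scalar !mxE !lshift0.
have dlE : @dlsubmx R 1 n 1 n M = b^T by rewrite /b trmx_ursub Msym.
have CT : C^T = C by rewrite /C trmx_drsub Msym.
have ME : M = block_mx a%:M b b^T C by rewrite -ulE -dlE submxK.
have bxC (x : 'rV_n) : (b *m x^T) 0 0 = (x *m b^T) 0 0.
  by rewrite -[in RHS](trmxK x) -trmx_mul [RHS]mxE.
have quad (t : R) (x : 'rV_n) :
    0 <= t ^+ 2 * a + 2 * t * (x *m b^T) 0 0 + (x *m C *m x^T) 0 0.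
  have := Mpsd (row_mx t%:M x).
  rewrite ME mul_row_block tr_row_mx mul_row_col tr_scalar_mx mul_mx_scalar.
  rewrite mulmxDl mul_scalar_mx mul_scalar_mx -scalemxAl.
  rewrite !mxE -!/(fun_of_matrix _ 0 0) eqxx mulr1n.
  have -> : \sum_j b 0 j * x^T j 0 = (x *m b^T) 0 0 by rewrite -bxC mxE.
  have -> : \sum_j x 0 j * b^T j 0 = (x *m b^T) 0 0 by rewrite mxE.
  have -> : \sum_j (x *m C) 0 j * x^T j 0 = (x *m C *m x^T) 0 0 by rewrite [RHS]mxE.
  set B := (x *m b^T) 0 0; set G := (x *m C *m x^T) 0 0.
  by have -> : t * (t * a + B) + (t * B + G) = t ^+ 2 * a + 2 * t * B + G by ring.
have a0 : 0 <= a.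
  by have := quad 1 0; rewrite !mul0mx !mxE; lra.
have b0 : a = 0 -> b = 0.
  move=> aE; apply/rowP => j; rewrite [RHS]mxE; apply/eqP; apply: contraT => bj.
  pose e : 'rV[R]_n := delta_mx 0 j.
  (* With zero corner this argument makes the form equal to [-1]. *)
  have := quad (- (C j j + 1) / (2 * b 0 j)) e.
  have -> : (e *m b^T) 0 0 = b 0 j by rewrite -rowE !mxE.
  have -> : (e *m C *m e^T) 0 0 = C j j.
    by rewrite -rowE trmx_delta -colE !mxE.
  have -> : 2 * (- (C j j + 1) / (2 * b 0 j)) * b 0 j = - (C j j + 1) by field.
  rewrite aE; lra.
have [Y YE] : exists Y : 'M[R]_n, C - a^-1 *: (b^T *m b) = Y *m Y^T.
  apply: IH; first by rewrite linearB /= linearZ /= trmx_mul trmxK CT.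
  (* The minimizer of the form in [t]. For [a = 0] the convention [0^-1 = 0] makes both the
     minimizer and the correction vanish. *)
  move=> x; have := quad (- a^-1 * (x *m b^T) 0 0) x.
  rewrite mulmxBr mulmxBl -scalemxAr -scalemxAl.
  rewrite [X in _ -> _ <= X]mxE [X in _ -> _ <= _ + X]mxE [X in _ -> _ <= _ - X]mxE.
  have -> : (x *m (b^T *m b) *m x^T) 0 0 = (x *m b^T) 0 0 ^+ 2.
    rewrite mulmxA -mulmxA mxE big_ord_recl big_ord0 addr0 bxC expr2.
    by congr (_ * _); rewrite ord1.
  set B := (x *m b^T) 0 0; set G := (x *m C *m x^T) 0 0.
  have [->|an0] := eqVneq a 0; first by rewrite invr0; nra.
  have -> : (- a^-1 * B) ^+ 2 * a + 2 * (- a^-1 * B) * B = - (a^-1 * B ^+ 2) by field.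
  lra.
pose r := Num.sqrt a.
have rr : r * r = a by rewrite -expr2 sqr_sqrtr.
have rb : r *: (r^-1 *: b) = b.
  have [aE|an0] := eqVneq a 0; first by rewrite b0 // !scaler0.
  by rewrite scalerA divff ?scale1r // sqrtr_eq0 -ltNge lt_neqAle eq_sym an0.
have rbb : r^-1 *: b^T *m (r^-1 *: b) = a^-1 *: (b^T *m b).
  by rewrite -scalemxAl -scalemxAr scalerA -invfM rr.
exists (block_mx r%:M 0 (r^-1 *: b^T) Y).
rewrite (@tr_block_mx _ 1 n 1 n) (@mulmx_block _ 1 n 1 n 1 n) ME.
have tb : (r^-1 *: b^T)^T = r^-1 *: b by rewrite linearZ /= trmxK.
have rbT : r *: (r^-1 *: b^T) = b^T.
  by apply/matrixP => i j; have /matrixP/(_ j i) := rb; rewrite !mxE.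
rewrite tr_scalar_mx tb trmx0 !mul0mx !mulmx0 !addr0.
by rewrite -scalar_mxM rr mul_scalar_mx rb mul_mx_scalar rbT rbb -YE addrC subrK.
Qed.

Lemma dotfC (I : finType) (x y : I -> R) : dotf x y = dotf y x.
Proof. by apply: eq_bigr => l _; rewrite mulrC. Qed.

(** The constructions below use many auxiliary coordinates; this brings any [n] vectors back into
    dimension [n] with the same inner products. *)
Lemma gram_realization n (I : finType) (y : 'I_n -> I -> R) :
  exists v : 'I_n -> 'rV[R]_n, forall i j, dotv (v i) (v j) = dotf (y i) (y j).
Proof.
pose Z : 'M[R]_(n, #|I|) := \matrix_(i, l) y i (enum_val l).
have [||Y YE] := @psd_factor n (Z *m Z^T); first by rewrite trmx_mul trmxK.
  move=> x; rewrite mulmxA -mulmxA -trmx_mul mxE sumr_ge0 // => l _.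
  by rewrite [X in _ * X]mxE -expr2 sqr_ge0.
exists (fun i => row i Y) => i j.
have -> : dotv (row i Y) (row j Y) = (Y *m Y^T) i j.
  by rewrite mxE; apply: eq_bigr => l _; rewrite !mxE.
rewrite -YE mxE /dotf [RHS](reindex (@enum_val I I)) /=; last first.
  exact/onW_bij/enum_val_bij.
by apply: eq_bigr => l _; rewrite !mxE.
Qed.

End GramMatrices.

(** * Reinserting deleted vertices into a vector coloring *)

Section Colorability.
Variables (R : realType) (n : nat).
Implicit Types (E : {set {set 'I_n}}) (B U S : {set 'I_n}) (P : bool -> R -> Prop).

(** What reinsertion needs of a notion of coloring. The second argument of [P] is an inner product
    plus 1: edges may get exactly 0, non-edges any nonnegative value, and values on non-edges may
    grow. *)
Definition admissible P : Prop :=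
  [/\ P true 0, (forall z, 0 <= z -> P false z)
    & forall z z', P false z -> z <= z' -> P false z'].

(* A vector [k]-coloring [v] of the subgraph induced by [B] is stored as the
   family [y i = sqrt (k - 1) v i], so that the edge conditions read
   [dotf (y i) (y j) + 1 <= 0], resp. [= 0]. *)
Definition colorable P E B (k : R) : Prop :=
  exists (I : finType) (y : 'I_n -> I -> R),
    (forall i, i \in B -> dotf (y i) (y i) <= k - 1) /\
    (forall i j, i \in B -> j \in B -> i != j -> P (adj E i j) (dotf (y i) (y j) + 1)).

Lemma dotf_sum (I J : finType) (x y : I + J -> R) :
  dotf x y = dotf (fun i => x (inl i)) (fun i => y (inl i)) +
             dotf (fun j => x (inr j)) (fun j => y (inr j)).
Proof. by rewrite /dotf big_sumType. Qed.

Lemma dotf_pair (I J : finType) (x y : I * J -> R) :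
  dotf x y = \sum_i dotf (fun j => x (i, j)) (fun j => y (i, j)).
Proof. by rewrite /dotf pair_big; apply: eq_bigr => -[]. Qed.

Lemma dotf0l (I : finType) (y : I -> R) : dotf (fun=> 0) y = 0.
Proof. by rewrite /dotf big1 // => i _; rewrite mul0r. Qed.

Lemma dotf0r (I : finType) (y : I -> R) : dotf y (fun=> 0) = 0.
Proof. by rewrite dotfC dotf0l. Qed.

Lemma dotf_delta (m : nat) (a : 'I_m) (x : R) (y : 'I_m -> R) :
  dotf (fun c => if a == c then x else 0) y = x * y a.
Proof.
rewrite /dotf (bigD1 a) //= eqxx big1 ?addr0 // => c /negbTE.
by rewrite eq_sym => ->; rewrite mul0r.
Qed.

(** The vertices of a regular simplex, scaled to squared norm [m - 1] and mutual inner product [-1]: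
    an ordinary [m]-coloring as a vector coloring. *)
Definition simplex (m : nat) (a : 'I_m) : 'I_m -> R :=
  fun c => Num.sqrt m%:R * ((a == c)%:R - m%:R^-1).

Lemma dotf_simplex (m : nat) (a b : 'I_m) : (0 < m)%N ->
  dotf (simplex a) (simplex b) = m%:R * (a == b)%:R - 1.
Proof.
move=> m0; have m0' : m%:R != 0 :> R by rewrite pnatr_eq0 -lt0n.
have s2 : Num.sqrt m%:R * Num.sqrt m%:R = m%:R :> R by rewrite -expr2 sqr_sqrtr.
transitivity (\sum_(c < m) (m%:R * ((if a == c then 1 else 0) * (b == c)%:R) -
   (if a == c then 1 else 0) - (if b == c then 1 else 0) + m%:R^-1) : R).
  apply: eq_bigr => c _; rewrite /simplex mulrACA s2.
  by case: eqP => _; case: eqP => _ /=; field.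
rewrite big_split sumrB sumrB /= -mulr_sumr.
have d x : \sum_(c < m) (if x == c then 1 else 0) = 1 :> R.
  by rewrite -big_mkcond (big_pred1 x) // => c; rewrite /= eq_sym.
rewrite !d sumr_const card_ord -[m%:R^-1 *+ m]mulr_natr mulVf //.
have -> : \sum_i (if a == i then 1 else 0) * (b == i)%:R = (a == b)%:R :> R.
  by rewrite [LHS](dotf_delta a 1) mul1r eq_sym.
ring.
Qed.

(** The handle is implicit in the [+ 1] of [colorable]. Each [u] in [U] owns [m] fresh coordinates,
    one per color of its neighborhood; a vertex outside [U] pays [al * al] in squared norm for each
    of its at most [d] neighbors in [U]. *)
Lemma colorable_extend P E U (k : R) (m d : nat) :
  admissible P -> (0 < m)%N -> m%:R < k ->
  colorable P E (~: U) k ->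
  (exists c : 'I_n -> 'I_m, proper_coloring E U c) ->
  (forall u, exists c : 'I_n -> 'I_m, proper_coloring E (nbrs E u) c) ->
  (forall w, w \notin U -> (#|nbrs E w :&: U| <= d)%N) ->
  colorable P E setT (k + m%:R * d%:R / (k - m%:R)).
Proof.
move=> [P10 P0 Pm] m0 mk [I [y [yk yP]]] [c cU] /choice[cn cnP] Ud.
have m0' : 0 < m%:R :> R by rewrite ltr0n.
have mn0 : m%:R != 0 :> R by rewrite gt_eqF.
have km0 : 0 < k - m%:R by rewrite subr_gt0.
(* Chosen so that a vertex of [U] has squared norm [m - 1 + m / al ^ 2 = k - 1]. *)
pose al : R := Num.sqrt (m%:R / (k - m%:R)).
have al2 : al * al = m%:R / (k - m%:R) by rewrite -expr2 sqr_sqrtr // divr_ge0 // ltW.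
have al0 : al != 0 by rewrite sqrtr_eq0 -ltNge divr_gt0.
have alV2 : al^-1 * al^-1 * m%:R = k - m%:R.
  by rewrite -invfM al2 invf_div divfK.
have al2p : 0 < m%:R / (k - m%:R) by rewrite divr_gt0.
(* On its own block [u] is constantly [al^-1], while a neighbor outside [U] has [- al] at its color
   only, so their inner product is [-1]. Inside [U] the simplex coordinates take care of the
   edges. *)
pose yn i (l : (I + 'I_m) + ('I_n * 'I_m)) : R :=
  match l with
  | inl (inl l) => if i \in U then 0 else y i l
  | inl (inr a) => if i \in U then simplex (c i) a else 0
  | inr (u, a) => if i \in U then (if u == i then al^-1 else 0)
                  else if (u \in nbrs E i :&: U) then
                         (if cn u i == a then - al else 0) else 0
  end.
have ynU i j : i \in U -> j \in U ->
    dotf (yn i) (yn j) = m%:R * (c i == c j)%:R - 1 + (i == j)%:R * (k - m%:R).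
  move=> iU jU; rewrite dotf_sum dotf_sum dotf_pair /yn iU jU dotf0l add0r.
  rewrite dotf_simplex //; congr (_ + _).
  rewrite (bigD1 i) //= eqxx big1 ?addr0; last first.
    by move=> u /negbTE ui; rewrite ui dotf0l.
  rewrite /dotf sumr_const card_ord; case: eqP => _; last by rewrite mulr0 mul0rn mul0r.
  by rewrite mul1r -alV2 mulr_natr.
have ynUW i j : i \in U -> j \notin U ->
    dotf (yn i) (yn j) = - (i \in nbrs E j)%:R.
  move=> iU jU; rewrite dotf_sum dotf_sum dotf_pair /yn iU (negbTE jU).
  rewrite dotf0l dotf0r !add0r (bigD1 i) //= eqxx big1 ?addr0; last first.
    by move=> u /negbTE ui; rewrite ui dotf0l.
  rewrite in_setI iU andbT; case: (i \in nbrs E j); last by rewrite dotf0r oppr0.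
  by rewrite dotfC dotf_delta mulNr mulfV.
have ynW i j : i \notin U -> j \notin U ->
    dotf (yn i) (yn j) = dotf (y i) (y j) +
      m%:R / (k - m%:R) * \sum_(u in U) ((u \in nbrs E i) && (u \in nbrs E j) &&
        (cn u i == cn u j))%:R.
  move=> iU jU; rewrite dotf_sum dotf_sum dotf_pair /yn (negbTE iU) (negbTE jU).
  rewrite dotf0l addr0; congr (_ + _).
  rewrite mulr_sumr [RHS]big_mkcond; apply: eq_bigr => u _.
  rewrite !in_setI; case: (u \in U); last by rewrite !andbF dotf0l.
  rewrite !andbT; case: (u \in nbrs E i); last by rewrite dotf0l mulr0.
  case: (u \in nbrs E j); last by rewrite dotf0r mulr0.
  rewrite dotf_delta /= eq_sym; case: eqP => _; last by rewrite !mulr0.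
  by rewrite mulrNN al2 mulr1.
exists ((I + 'I_m) + ('I_n * 'I_m))%type, yn; split=> [i _|i j _ _ ij].
  have [iU|iU] := boolP (i \in U).
    rewrite ynU // !eqxx mulr1 mul1r.
    have : 0 <= m%:R * d%:R / (k - m%:R) by rewrite divr_ge0 ?mulr_ge0 // ltW.
    lra.
  rewrite ynW // [leRHS]addrAC; apply: lerD; first by rewrite yk ?inE.
  rewrite [leRHS]mulrAC; apply: ler_wpM2l; first exact: ltW.
  apply: (@le_trans _ _ #|nbrs E i :&: U|%:R); last by rewrite ler_nat Ud.
  rewrite -sum1_card natr_sum big_mkcond [leRHS]big_mkcond; apply: ler_sum => u _.
  by rewrite in_setI andbC; case: (u \in U) => //=; case: (u \in nbrs E i) => //=; rewrite ?eqxx.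
have [iU|iU] := boolP (i \in U); have [jU|jU] := boolP (j \in U).
- rewrite ynU // (negbTE ij) mul0r addr0 subrK.
  case aij : (adj E i j); last by apply: P0; rewrite mulr_ge0.
  by rewrite (negbTE (cU _ _ iU jU ij aij)) mulr0.
- rewrite ynUW // inE ij [adj E j i]adjC /=; case: (adj E i j) => /=; first by rewrite addNr.
  by apply: P0; rewrite oppr0 add0r.
- rewrite dotfC ynUW // inE eq_sym ij /=; case: (adj E i j) => /=; first by rewrite addNr.
  by apply: P0; rewrite oppr0 add0r.
- rewrite ynW //.
  have := yP i j; rewrite !inE iU jU => /(_ isT isT ij).
  (* Adjacent vertices with a common neighbor [u] have different colors in [cn u], so their inner
     product is unchanged; for non-adjacent ones it can only increase. *)
  case aij : (adj E i j) => yij.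
    rewrite big1 ?mulr0 ?addr0 // => u uU.
    case ui : (u \in nbrs E i) => //=; case uj : (u \in nbrs E j) => //=.
    rewrite (negbTE (cnP u i j _ _ ij aij)) //.
    + by move: ui; rewrite !inE eq_sym adjC.
    + by move: uj; rewrite !inE eq_sym adjC.
  apply: Pm yij _; rewrite lerD2r lerDl mulr_ge0 ?sumr_ge0 //; exact: ltW.
Qed.

End Colorability.

(** * The three parameters and their concentration *)

Section Theta.
Variables (R : realType) (n : nat).
Implicit Types (E F : {set {set 'I_n}}) (B U S : {set 'I_n}) (P : bool -> R -> Prop).

Definition half_kind (b : bool) (z : R) : Prop := b -> z <= 0.
Definition strict_kind (b : bool) (z : R) : Prop := b -> z = 0.
Definition rigid_kind (b : bool) (z : R) : Prop := if b then z = 0 else 0 <= z.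

Lemma half_kind_admissible : admissible half_kind.
Proof. by split. Qed.

Lemma strict_kind_admissible : admissible strict_kind.
Proof. by split. Qed.

Lemma rigid_kind_admissible : admissible rigid_kind.
Proof. by split => // z z' /=; apply: le_trans. Qed.

Lemma colorable_unit P E (k : R) : 1 < k ->
  colorable P E setT k <->
  exists v : 'I_n -> 'rV[R]_n, (forall i, dotv (v i) (v i) = 1) /\
    forall i j, i != j -> P (adj E i j) ((k - 1) * dotv (v i) (v j) + 1).
Proof.
move=> k1; have k0 : 0 < k - 1 by rewrite subr_gt0.
have s2 : Num.sqrt (k - 1) * Num.sqrt (k - 1) = k - 1 by rewrite -expr2 sqr_sqrtr // ltW.
have s0 : Num.sqrt (k - 1) != 0 by rewrite sqrtr_eq0 -ltNge.
split=> [[I [y [yk yP]]]|[v [v1 vP]]].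
  (* A private coordinate for each vertex pads its squared norm to [k - 1] without touching inner
     products of distinct vertices; then everything is scaled to unit length. *)
  pose z i (l : I + 'I_n) : R := match l with
    | inl l => (Num.sqrt (k - 1))^-1 * y i l
    | inr a => (Num.sqrt (k - 1))^-1 *
        (if i == a then Num.sqrt (k - 1 - dotf (y i) (y i)) else 0) end.
  have dZ (J : finType) (a : R) (x x' : J -> R) :
      dotf (fun l => a * x l) (fun l => a * x' l) = a * a * dotf x x'.
    by rewrite /dotf mulr_sumr; apply: eq_bigr => l _; rewrite mulrACA.
  have [v vz] := gram_realization z.
  have dz i j : (k - 1) * dotf (z i) (z j) = dotf (y i) (y j) +
      (if i == j then k - 1 - dotf (y i) (y i) else 0).
    rewrite dotf_sum /= !dZ -invfM s2 -mulrDr mulVKf ?(gt_eqF k0) //; congr (_ + _).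
    rewrite dotf_delta eq_sym; case: eqP => [->|_]; last by rewrite mulr0.
    by rewrite -expr2 sqr_sqrtr // subr_ge0 yk ?inE.
  exists v; split=> [i|i j ij].
    apply: (mulfI (negbT (gt_eqF k0))).
    by rewrite vz dz eqxx mulr1 addrC subrK.
  by rewrite vz dz (negbTE ij) addr0; apply: yP; rewrite ?inE.
exists 'I_n, (fun i l => Num.sqrt (k - 1) * v i 0 l).
have dE i j : dotf (fun l => Num.sqrt (k - 1) * v i 0 l)
     (fun l => Num.sqrt (k - 1) * v j 0 l) = (k - 1) * dotv (v i) (v j).
  by rewrite /dotf /dotv mulr_sumr; apply: eq_bigr => l _; rewrite mulrACA s2.
split=> [i _|i j _ _ ij]; rewrite dE; first by rewrite v1 mulr1.
exact: vP.
Qed.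

Definition theta P E : R := inf [set k : R | 1 < k /\ colorable P E setT k]%classic.

Lemma half_le (k d : R) : 1 < k -> (k - 1) * d + 1 <= 0 <-> d <= - (k - 1)^-1.
Proof.
move=> k1; have k0 : 0 < k - 1 by rewrite subr_gt0.
have := ler_pM2l k0 d (- (k - 1)^-1); rewrite mulrN mulfV ?gt_eqF // => <-.
by split; lra.
Qed.

Lemma rigid_le (k d : R) : 1 < k -> 0 <= (k - 1) * d + 1 <-> - (k - 1)^-1 <= d.
Proof.
move=> k1; have k0 : 0 < k - 1 by rewrite subr_gt0.
have := ler_pM2l k0 (- (k - 1)^-1) d; rewrite mulrN mulfV ?gt_eqF // => <-.
by split; lra.
Qed.

Lemma theta_halfE E : theta_half E = theta half_kind E.
Proof.
congr inf; apply/seteqP; split=> k [k1 Ek]; split=> //.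
  apply/colorable_unit => //; case: Ek => v [v1 vE]; exists v; split=> // i j ij a.
  exact/half_le/vE.
case/(colorable_unit _ _ k1): Ek => v [v1 vE]; exists v; split=> // i j ij a.
exact/half_le/vE.
Qed.

Lemma strict_eq (k d : R) : 1 < k -> (k - 1) * d + 1 = 0 <-> d = - (k - 1)^-1.
Proof.
move=> k1; have k0 : k - 1 != 0 by rewrite gt_eqF // subr_gt0.
split=> [h|->]; last by rewrite mulrN mulfV // addNr.
by apply: (mulfI k0); rewrite mulrN mulfV //; lra.
Qed.

Lemma theta_barE E : theta_bar E = theta strict_kind E.
Proof.
congr inf; apply/seteqP; split=> k [k1 Ek]; split=> //.
  apply/colorable_unit => //; case: Ek => v [v1 vE]; exists v; split=> // i j ij a.
  exact/strict_eq/vE.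
case/(colorable_unit _ _ k1): Ek => v [v1 vE]; exists v; split=> // i j ij a.
exact/strict_eq/vE.
Qed.

Lemma theta_twoE E : theta_two E = theta rigid_kind E.
Proof.
congr inf; apply/seteqP; split=> k [k1 Ek]; split=> //.
  apply/colorable_unit => //; case: Ek => v [[v1 vE] vN]; exists v; split=> // i j ij.
  rewrite /rigid_kind; case: ifP => a; first exact/strict_eq/vE.
  by apply/rigid_le => //; apply: vN => //; rewrite a.
case/(colorable_unit _ _ k1): Ek => v [v1 vE]; exists v; split; first split=> //.
  by move=> i j ij a; have := vE i j ij; rewrite a /= => /strict_eq ->.
by move=> i j ij /negbTE a; have := vE i j ij; rewrite a /= => /rigid_le ->.
Qed.

Lemma colorable_le P E B (k k' : R) : k <= k' -> colorable P E B k -> colorable P E B k'.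
Proof.
move=> kk [I [y [yk yP]]]; exists I, y; split=> // i /yk; lra.
Qed.

Lemma colorable_subset P E B B' (k : R) :
  B' \subset B -> colorable P E B k -> colorable P E B' k.
Proof.
move=> /subsetP BB [I [y [yk yP]]]; exists I, y; split=> [i /BB /yk //|i j iB jB].
by apply: yP; apply: BB.
Qed.

Lemma colorable0 P E (k : R) : colorable P E set0 k.
Proof. by exists 'I_n, (fun _ _ => 0); split=> i; rewrite inE. Qed.

Section Bounds.
Hypothesis n2 : (2 <= n)%N.
Variable P : bool -> R -> Prop.
Hypothesis PA : admissible P.

Lemma colorable_order E : colorable P E setT n%:R.
Proof.
have n0 : (0 < n)%N by apply: ltnW.
exists 'I_n, (fun i => simplex R i); split=> [i _|i j _ _ ij].
  by rewrite dotf_simplex // eqxx mulr1.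
rewrite dotf_simplex // (negbTE ij) mulr0 sub0r addNr.
by case: PA => P10 P0 _; case: (adj E i j); [|apply: P0].
Qed.

(** Guarantees that the [inf] in [theta] is a true infimum; the simplex coloring with [n] colors is
    a witness. *)
Lemma has_inf_theta E : has_inf [set k : R | 1 < k /\ colorable P E setT k]%classic.
Proof.
split; last by exists 1 => k [/ltW].
exists n%:R; split; last exact: colorable_order.
by rewrite ltr1n.
Qed.

Lemma theta_le E (k : R) : 1 < k -> colorable P E setT k -> theta P E <= k.
Proof. by move=> k1 Ek; apply: ge_inf; [case: (has_inf_theta E)|]. Qed.

(** Attainment of the infimum is avoided: norms in [colorable] are only bounded above, so
    colorability persists for larger [k]. *)
Lemma theta_lt_colorable E (k : R) : theta P E < k -> 1 < k /\ colorable P E setT k.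
Proof.
move=> /(inf_lt (has_inf_theta E).1)[k' [k1 Ek] kk]; split; first exact: lt_trans kk.
exact: colorable_le (ltW kk) Ek.
Qed.

End Bounds.

Lemma theta_half_le P E : (2 <= n)%N -> admissible P ->
  (forall z, P true z -> z <= 0) -> theta half_kind E <= theta P E.
Proof.
move=> n2 PA PH; apply: lb_le_inf; first by case: (has_inf_theta n2 PA E).
move=> k [k1 [I [y [yk yP]]]]; apply: (theta_le n2 half_kind_admissible k1).
exists I, y; split=> // i j iT jT ij a; apply: PH.
by have := yP i j iT jT ij; rewrite a.
Qed.

Definition defect P (k : R) E : nat :=
  #|[arg min_(U < [set: 'I_n] | `[< colorable P E (~: U) k >]) #|U| ]|.

Lemma defectP P k E : exists2 U, colorable P E (~: U) k &
  #|U| = defect P k E /\ forall U', colorable P E (~: U') k -> (defect P k E <= #|U'|)%N.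
Proof.
rewrite /defect; case: arg_minnP => [|U /asboolP UE Umin].
  by apply/asboolP; rewrite setCT; apply: colorable0.
by exists U => //; split=> // U' U'E; apply: Umin; apply/asboolP.
Qed.

Definition star (i : 'I_n) := [set e in pairs n | i \in e].

(** Two graphs differing only at [i] coincide once [i] is deleted too. *)
Lemma defect_lipschitz P k i : lipschitz_on (star i) (fun E => (defect P k E)%:R : R).
Proof.
move=> E F EF; have [U UF [<- _]] := defectP P k F.
have [_ _ [_ Emin]] := defectP P k E.
rewrite natr1 ler_nat; apply: (@leq_trans #|i |: U|); last first.
  by rewrite cardsU1; case: (i \in U).
apply: Emin; case: UF => I [y [yk yP]]; exists I, y.
have sub x : x \in ~: (i |: U) -> x \in ~: U by rewrite !inE; case: eqP.
split=> [j /sub /yk //|a b aU bU ab].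
have -> : adj E a b = adj F a b.
  have abi : [set a; b] \notin star i.
    move: aU bU; rewrite !inE !(eq_sym i) => /norP[/negbTE -> _] /norP[/negbTE -> _].
    by rewrite andbF.
  by move/setP/(_ [set a; b]): EF; rewrite !in_setD abi.
by apply: yP => //; apply: sub.
Qed.

(** The threshold is [m + m ^ 2] for [m = 2 * r], the size of [k] from which reinsertion is
    cheap. *)
Lemma theta_concentration P (p lam : R) (r : nat) :
  admissible P -> (forall z, P true z -> z <= 0) ->
  (2 <= n)%N -> 0 <= p <= 1 -> 1 <= lam -> (0 < r)%N ->
  4 * n%:R / lam ^+ 2 <= 1 ->
  prob (pairs n) p (fun E => theta half_kind E < (2 * r + 4 * r * r)%:R) <
    4 * n%:R / lam ^+ 2 ->
  exists u : R, prob (pairs n) p (fun E => ~ (u <= theta P E /\ theta P E <= u + 2)) <=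
    2 * (4 * n%:R / lam ^+ 2) +
    prob (pairs n) p (fun E => ~ sparse E r (2 * lam)) +
    prob (pairs n) p (fun E => exists2 v : 'I_n, true & 2 * lam < #|nbrs E v|%:R).
Proof.
move=> PA PH n2 p01 lam1 r0; set eps := _ / _ => eps1 low.
have lam0 : 0 < lam by apply: lt_le_trans lam1.
have eps0 : 0 < eps.
  by rewrite divr_gt0 ?exprn_gt0 // mulr_gt0 // ltr0n ltnW.
have [|u [ule ult]] := @expect_quantile R _ (pairs n) p p01 (theta P) eps.
  by rewrite ltW.
(* Otherwise [theta P E <= u], of probability at least [eps], would imply the event of the
   hypothesis, of probability below [eps]. *)
exists u; have uK : (2 * r + 4 * r * r)%:R <= u.
  rewrite leNgt; apply/negP => uK.
  have : prob (pairs n) p (fun E => theta P E <= u) <=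
         prob (pairs n) p (fun E => theta half_kind E < (2 * r + 4 * r * r)%:R).
    apply: ler_prob => // E _ Eu; apply: le_lt_trans uK; apply: le_trans Eu.
    exact: theta_half_le.
  by move=> /(le_trans ule); rewrite leNgt low.
(* If [theta P E <= u] then the graph is colorable at [u + 1], with defect 0. The extra 1 makes the
   inequality strict. *)
have tail : prob (pairs n) p (fun E => lam < (defect P (u + 1) E)%:R) <= eps.
  have := @lipschitz_tail R _ (pairs n) p p01 'I_n star
    (fun E => (defect P (u + 1) E)%:R) lam.
  rewrite card_ord; apply => //.
  - by move=> i; apply/subsetP => e; rewrite inE => /andP[].
  - move=> e eP; move: (eP); rewrite inE => /eqP e2.
    have /set0Pn[i ie] : e != set0 by rewrite -card_gt0 e2.
    by exists i; rewrite inE eP.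
  - by move=> i; apply: defect_lipschitz.
  - exact: ltnW.
  - apply: le_trans ule _; apply: ler_prob => // E _ Eu.
    have [_ _ [_ /(_ set0)]] := defectP P (u + 1) E.
    rewrite cards0 leqn0 => H; apply/eqP; rewrite pnatr_eq0; apply: H.
    have [|_] := @theta_lt_colorable n2 P PA E (u + 1); first by lra.
    by rewrite setC0.
apply: le_trans (_ : prob (pairs n) p (fun E => ((theta P E < u \/
   lam < (defect P (u + 1) E)%:R) \/ ~ sparse E r (2 * lam)) \/
   (exists2 v : 'I_n, true & 2 * lam < #|nbrs E v|%:R)) <= _).
  apply: ler_prob => // E gE; apply: contra_notP => /not_orP[/not_orP[/not_orP[Eu Ed] Es] Ev].
  split; first by rewrite leNgt; apply/negP.
  have {}Ed : (defect P (u + 1) E)%:R <= lam by rewrite leNgt; apply/negP.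
  have {}Es : sparse E r (2 * lam) by apply: contrapT.
  have [U UE [Ud _]] := defectP P (u + 1) E.
  rewrite -Ud in Ed.
  have [X [UX X2 Xd]] := sparse_closure gE r0 lam1 Es Ed.
  have m2 : (0 < 2 * r)%N by rewrite muln_gt0.
  have uK' : (2 * r)%:R + (4 * r * r)%:R <= u by rewrite -natrD.
  have m0 : 0 <= (2 * r)%:R :> R by [].
  have mm0 : 0 <= (4 * r * r)%:R :> R by [].
  have mm : (2 * r)%:R * (2 * r)%:R = (4 * r * r)%:R :> R by rewrite !natrM; ring.
  have km : (2 * r)%:R < u + 1 by lra.
  have deg v : #|nbrs E v|%:R <= 2 * lam.
    by rewrite leNgt; apply/negP => vl; apply: Ev; exists v.
  have XU : ~: X \subset ~: U by rewrite setCS.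
  have EX := colorable_extend PA m2 km
    (colorable_subset XU UE)
    (sparse_coloring gE r0 Es X2)
    (fun v => sparse_coloring gE r0 Es (deg v))
    (fun w wX => ltnW (Xd w wX)).
  apply: theta_le => //; first by lra.
  apply: colorable_le EX.
  (* The cost of reinsertion, which leads from [u + 1] to [u + 2]. *)
  have : (2 * r)%:R * (2 * r)%:R / (u + 1 - (2 * r)%:R) <= 1.
    by rewrite mm ler_pdivrMr ?mul1r ?subr_gt0 //; move: uK'; set q := (4 * r * r)%:R; set m := (2 * r)%:R; lra.
  lra.
apply: (le_trans (prob_or _ p01 _ _)); rewrite lerD2r.
apply: (le_trans (prob_or _ p01 _ _)); rewrite lerD2r.
apply: (le_trans (prob_or _ p01 _ _)); lra.
Qed.

End Theta.

(** * Lower bound on the vector chromatic number *)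

Section RandomSigns.
Variables (R : realType) (n : nat).
Implicit Types (S : {set 'I_n}) (x y : 'I_n -> R) (r : seq 'I_n).

Local Notation half := (2^-1 : R).
Local Notation mean f := (expect [set: 'I_n] half f).

Definition sign S i : R := if i \in S then 1 else -1.

Definition walk x r S : R := \sum_(l <- r) x l * sign S l.

Lemma half01 : 0 <= half <= 1.
Proof. lra. Qed.

Lemma walk_insensitive x r e S : e \notin r ->
  walk x r (e |: S) = walk x r S /\ walk x r (S :\ e) = walk x r S.
Proof.
move=> er; split; rewrite /walk big_seq [RHS]big_seq; apply: eq_bigr => l lr;
  by rewrite /sign !inE; case: eqP => // le; rewrite -le lr in er.
Qed.

Lemma resample_walk2 (g : R -> R -> R) x y e r S : e \notin r ->
  resample half e (fun S => g (walk x (e :: r) S) (walk y (e :: r) S)) S =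
  half * (g (x e + walk x r S) (y e + walk y r S) +
          g (- x e + walk x r S) (- y e + walk y r S)).
Proof.
move=> er; have [x1 x2] := walk_insensitive x S er; have [y1 y2] := walk_insensitive y S er.
rewrite /resample /walk !big_cons -!/(walk _ _ _) x1 x2 y1 y2 /sign setU11 setD11.
by rewrite !mulr1 !mulrN1; lra.
Qed.

Lemma mean_walk_cov x y r : uniq r ->
  mean (fun S => walk x r S * walk y r S) = \sum_(l <- r) x l * y l.
Proof.
elim: r => [_|e r IH /= /andP[er /IH {}IH]].
  by rewrite big_nil -[RHS](expect_cst [set: 'I_n] half); apply: eq_expect => S _; rewrite /walk big_nil mul0r.
rewrite -(expect_resample half _ (in_setT e)) big_cons -IH.
rewrite -[x e * y e](expect_cst [set: 'I_n] half) -expectD; apply: eq_expect => S _.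
by rewrite (resample_walk2 *%R) //; field.
Qed.

(** Khintchine's inequality for the fourth moment: averaging over one sign cancels the odd
    powers. *)
Lemma mean_walk4 x r : uniq r ->
  mean (fun S => walk x r S ^+ 4) <= 3 * (\sum_(l <- r) x l * x l) ^+ 2.
Proof.
elim: r => [_|e r IH /= /andP[er ur]].
  rewrite big_nil expr0n mulr0 -(expect_cst [set: 'I_n] half 0).
  by apply: ler_expect => [|S _]; [exact: half01|rewrite /walk big_nil expr0n].
have {}IH := IH ur.
rewrite -(expect_resample half _ (in_setT e)) big_cons.
rewrite (eq_expect _ (g := fun S => walk x r S ^+ 4 +
   (6 * x e ^+ 2 * (walk x r S * walk x r S) + x e ^+ 4))); last first.
  by move=> S _; rewrite (resample_walk2 (fun a _ => a ^+ 4) x x) //; field.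
rewrite !expectD expectZ mean_walk_cov // expect_cst.
set s := \sum_(l <- r) _ in IH *.
have s0 : 0 <= s by apply: sumr_ge0 => l _; rewrite -expr2 sqr_ge0.
have : 0 <= x e ^+ 4 by rewrite exprn_even_ge0.
have -> : 3 * (x e * x e + s) ^+ 2 = 3 * s ^+ 2 + 6 * x e ^+ 2 * s + 3 * x e ^+ 4 by ring.
lra.
Qed.

Lemma mean_le_ex (f : {set 'I_n} -> R) c : mean f <= c -> exists S, f S <= c.
Proof.
case: (@arg_minP _ _ _ [set: 'I_n] predT f isT) => S _ Smin fc.
exists S; apply: le_trans fc; rewrite -[leLHS](expect_cst [set: 'I_n] half).
by apply: ler_expect => [|S' _]; [exact: half01|exact: Smin].
Qed.

Definition clip (M t : R) : R := if M < t then M else if t < - M then - M else t.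

Lemma clip_bound M t : 0 < M -> - M <= clip M t <= M.
Proof.
by move=> M0; rewrite /clip; case: ltP => h1; [|case: ltP => h2]; lra.
Qed.

(** The excess [d] of [t] in absolute value over [M] satisfies [4 * M * d <= t ^+ 2], because the
    square of the absolute value minus [2 * M] is nonnegative. *)
Lemma clip_error M t : 0 < M -> 16 * M ^+ 2 * (t - clip M t) ^+ 2 <= t ^+ 4.
Proof.
move=> M0.
have H d : 0 <= d -> 4 * M * d <= t ^+ 2 -> 16 * M ^+ 2 * d ^+ 2 <= t ^+ 4.
  move=> d0 dt; have -> : 16 * M ^+ 2 * d ^+ 2 = (4 * M * d) ^+ 2 by ring.
  have -> : t ^+ 4 = (t ^+ 2) ^+ 2 by rewrite -exprM.
  by rewrite ler_sqr // ?nnegrE ?sqr_ge0 // !mulr_ge0 // ltW.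
rewrite /clip; case: ltP => h1; [|case: ltP => h2].
- by apply: H; [lra|have := sqr_ge0 (t - 2 * M); lra].
- have -> : (t - - M) ^+ 2 = (- t - M) ^+ 2 by ring.
  apply: H; first lra.
  by have := sqr_ge0 (t + 2 * M); lra.
- by rewrite subrr expr0n mulr0 exprn_even_ge0.
Qed.

(** For second moments 1 and fourth moments at most 3 the error term has mean below [a / 2], so a
    correlation of [- a] survives truncation at [4 / a] as at most [- a / 2]. *)
Lemma clip_product (a s t : R) : 0 < a <= 1 ->
  clip (4 / a) s * clip (4 / a) t <=
  s * t + (a / 16 * (s * s + t * t) + a * 9 / 512 * (s ^+ 4 + t ^+ 4)).
Proof.
move=> /andP[a0 a1]; have M0 : 0 < 4 / a by rewrite divr_gt0.
have err u : (u - clip (4 / a) u) ^+ 2 <= a ^+ 2 / 256 * u ^+ 4.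
  have := clip_error u M0; have -> : 16 * (4 / a) ^+ 2 = 256 / a ^+ 2 by field; lra.
  move=> h; have a2 : 0 < a ^+ 2 / 256 by have := exprn_gt0 2 a0; lra.
  have := h; rewrite -(ler_pM2l a2) mulrA.
  by have -> : a ^+ 2 / 256 * (256 / a ^+ 2) = 1 by [field; lra]; rewrite mul1r.
have := err s; have := err t; set ds := _ - clip _ s; set dt := _ - clip _ t.
have -> : clip (4 / a) s = s - ds by rewrite /ds; ring.
have -> : clip (4 / a) t = t - dt by rewrite /dt; ring.
move=> et es.
have cross (x d t' : R) : d ^+ 2 <= a ^+ 2 / 256 * t' ^+ 4 ->
    - (x * d) <= a / 16 * (x * x) + a / 64 * t' ^+ 4.
  move=> dt'; rewrite -(ler_pM2l a0).
  have := sqr_ge0 (a / 4 * x + 2 * d).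
  have -> : (a / 4 * x + 2 * d) ^+ 2 = a ^+ 2 / 16 * (x * x) + a * (x * d) + 4 * d ^+ 2 by field.
  have -> : a * (a / 16 * (x * x) + a / 64 * t' ^+ 4) =
     a ^+ 2 / 16 * (x * x) + 4 * (a ^+ 2 / 256 * t' ^+ 4) by field.
  lra.
have h1 := cross s _ _ et; have h2 := cross t _ _ es.
have h3 := sqr_ge0 (ds - dt).
have h4 u : a ^+ 2 / 256 * u ^+ 4 <= a / 256 * u ^+ 4.
  have u4 : 0 <= u ^+ 4 by rewrite exprn_even_ge0.
  have aa : 0 <= a - a ^+ 2 by nra.
  by have := mulr_ge0 aa u4; lra.
have := h4 s; have := h4 t.
have -> : (s - ds) * (t - dt) = s * t + - (s * dt) + - (t * ds) + ds * dt by ring.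
have : ds * dt <= (ds ^+ 2 + dt ^+ 2) / 2 by lra.
lra.
Qed.

(** For signs [psi] this is the number of uncut edges minus the number of cut edges. *)
Definition edge_sum (E : {set {set 'I_n}}) (psi : 'I_n -> R) : R :=
  \sum_(e in E) \prod_(i in e) psi i.

Definition update (psi : 'I_n -> R) i t : 'I_n -> R := fun k => if k == i then t else psi k.

Lemma edge_sum_affine E psi i : edge_sum E psi =
  (1 + psi i) / 2 * edge_sum E (update psi i 1) +
  (1 - psi i) / 2 * edge_sum E (update psi i (-1)).
Proof.
rewrite /edge_sum !mulr_sumr -big_split; apply: eq_bigr => e _ /=.
have [ie|ie] := boolP (i \in e).
  have D (f : 'I_n -> R) : \prod_(k in e) f k = f i * \prod_(k in e | k != i) f k by rewrite (bigD1 i).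
  rewrite !D /update eqxx.
  have H t : \prod_(k in e | k != i) (if k == i then t else psi k) = \prod_(k in e | k != i) psi k.
    by apply: eq_bigr => k /andP[_ /negbTE ->].
  by rewrite !H; field.
have H t : \prod_(k in e) update psi i t k = \prod_(k in e) psi k.
  apply: eq_bigr => k ke; rewrite /update ifN //.
  by apply: contra ie => /eqP <-.
by rewrite !H; field.
Qed.

(** The sum is affine in each coordinate separately, so the coordinates can be moved one by one to
    an endpoint without increasing it. *)
Lemma edge_sum_extreme E psi : (forall i, -1 <= psi i <= 1) ->
  exists S, edge_sum E (sign S) <= edge_sum E psi.
Proof.
move=> psi1.
have [psi' [p1 p2]] : exists psi', (forall i, psi' i = 1 \/ psi' i = -1) /\
    edge_sum E psi' <= edge_sum E psi.
  have H r : exists psi', [/\ forall i, -1 <= psi' i <= 1,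
      forall i, i \in r -> psi' i = 1 \/ psi' i = -1 & edge_sum E psi' <= edge_sum E psi].
    elim: r => [|i r [f [f1 fr fE]]]; first by exists psi.
    have aff := edge_sum_affine E f i; have /andP[fi1 fi2] := f1 i.
    have upd t : t = 1 \/ t = -1 -> (forall k, -1 <= update f i t k <= 1) /\
        forall k, k \in i :: r -> update f i t k = 1 \/ update f i t k = -1.
      move=> t1; split=> k; rewrite /update.
        by case: eqP => // _; case: t1 => ->; lra.
      by rewrite inE; case: eqP => [_ _|_ /= /fr].
    have [le|lt] := leP (edge_sum E (update f i 1)) (edge_sum E (update f i (-1))).
      have [u1 u2] := upd 1 (or_introl erefl).
      by exists (update f i 1); split=> //; nra.
    have [u1 u2] := upd (-1) (or_intror erefl).
    by exists (update f i (-1)); split=> //; nra.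
  have [f [_ f1 fE]] := H (enum 'I_n); exists f; split=> // i.
  by apply: f1; rewrite mem_enum.
exists [set i | psi' i == 1]; apply: le_trans p2.
rewrite le_eqVlt; apply/orP; left; apply/eqP/eq_bigr => e _; apply: eq_bigr => i _.
rewrite /sign inE; case: (p1 i) => ->; rewrite ?eqxx // ifF //.
by apply: lt_eqF; lra.
Qed.

(* Rounding the vectors [v i] to the random reals [clip (4 / a) (walk (v i))],
   truncated only to make them bounded, and then to signs. *)
Lemma vectors_to_cut (E : {set {set 'I_n}}) (v : 'I_n -> 'rV[R]_n) (a : R) :
  is_graph E -> 0 < a <= 1 -> (forall i, dotv (v i) (v i) = 1) ->
  (forall i j, i != j -> adj E i j -> dotv (v i) (v j) <= - a) ->
  exists S, edge_sum E (sign S) <= - (a ^+ 3 / 32) * #|E|%:R.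
Proof.
move=> gE a01 v1 va; have /andP[a0 a1] := a01.
pose X i S := walk (v i 0) (index_enum 'I_n) S.
have cov i j : mean (fun S => X i S * X j S) = dotv (v i) (v j).
  by rewrite mean_walk_cov ?index_enum_uniq.
have X4 i : mean (fun S => X i S ^+ 4) <= 3.
  apply: le_trans (mean_walk4 _ (index_enum_uniq _)) _.
  by have := v1 i; rewrite /dotv => ->; rewrite expr1n mulr1.
have M0 : 0 < 4 / a by rewrite divr_gt0.
have [|S SE] := @mean_le_ex (fun S => edge_sum E (fun i => clip (4 / a) (X i S))) (- (a / 2) * #|E|%:R).
  rewrite expect_sum mulr_natr -sumr_const; apply: ler_sum => e eE.
  have /cards2P[i [j [ij eij]]] : #|e| == 2.
    by have := subsetP gE e eE; rewrite inE.
  have aij : adj E i j by rewrite /adj -eij.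
  apply: (@le_trans _ _ (mean (fun S => X i S * X j S + (a / 16 * (X i S * X i S + X j S * X j S)
     + a * 9 / 512 * (X i S ^+ 4 + X j S ^+ 4))))).
    apply: ler_expect => [|S _]; first exact: half01.
    by rewrite eij big_setU1 ?inE //= big_set1; apply: clip_product.
  rewrite !(expectD, expectZ) !cov !v1.
  have := va i j ij aij; have := X4 i; have := X4 j; nra.
(* Scaling by [a / 4] puts the values into the unit interval around 0; the factor [a ^ 2 / 16] turns
   [a / 2] into [a ^ 3 / 32]. *)
have [|S' S'E] := @edge_sum_extreme E (fun i => (4 / a)^-1 * clip (4 / a) (X i S)).
  move=> i; have /andP[c1 c2] := clip_bound (X i S) M0.
  have V0 : 0 < (4 / a)^-1 by rewrite invr_gt0.
  rewrite -(ler_pM2l V0) mulrN mulVf ?gt_eqF // in c1.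
  by rewrite -(ler_pM2l V0) mulVf ?gt_eqF // in c2; rewrite c1 c2.
exists S'; apply: (le_trans S'E).
have -> : edge_sum E (fun i => (4 / a)^-1 * clip (4 / a) (X i S)) =
    (4 / a)^-1 ^+ 2 * edge_sum E (fun i => clip (4 / a) (X i S)).
  rewrite /edge_sum mulr_sumr; apply: eq_bigr => e eE.
  rewrite big_split /= prodr_const; congr (_ ^+ _ * _).
  by have := subsetP gE e eE; rewrite inE => /eqP.
have m2 : 0 < (4 / a)^-1 ^+ 2 by rewrite exprn_gt0 // invr_gt0.
rewrite -(ler_pM2l m2) in SE; apply: (le_trans SE).
rewrite le_eqVlt; apply/orP; left; apply/eqP; field; lra.
Qed.

End RandomSigns.

(** * A Chernoff bound and a union bound over cuts *)

Section LowerBound.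
Variables (R : realType) (n : nat).
Implicit Types (E : {set {set 'I_n}}) (S : {set 'I_n}).

(** Follows from [expR y <= (1 - y)^-1], itself the tangent bound at [- y]. *)
Lemma expR_le_quadratic (y : R) : y <= 2^-1 -> expR y <= 1 + y + 2 * y ^+ 2.
Proof.
move=> y2; have := expR_ge1Dx (- y); rewrite expRN => h.
have e0 := expR_gt0 y.
have y0 : 0 < 1 - y by lra.
have : expR y * (1 - y) <= 1.
  by rewrite mulrC -ler_pdivlMr // mul1r.
have : 1 <= (1 + y + 2 * y ^+ 2) * (1 - y).
  have -> : (1 + y + 2 * y ^+ 2) * (1 - y) = 1 + y ^+ 2 * (1 - 2 * y) by ring.
  by rewrite lerDl mulr_ge0 ?sqr_ge0 //; lra.
move=> h1 h2; rewrite -(ler_pM2r y0); exact: le_trans h2 h1.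
Qed.

Lemma card_pairs : 2 * #|pairs n|%:R = n%:R * (n%:R - 1) :> R.
Proof.
rewrite -sum1_card natr_sum -(sum_pairs (fun=> 1)).
rewrite (eq_bigr (fun=> n%:R - 1)) => [|i _].
  by rewrite sumr_const card_ord mulr_natl.
have -> : n%:R - 1 = \sum_(j < n) 1 - 1 :> R by rewrite sumr_const card_ord.
by rewrite [in RHS](bigD1 i) //= addrAC subrr add0r.
Qed.

Lemma prod_sign S (i j : 'I_n) : i != j ->
  \prod_(k in [set i; j]) sign R S k = sign R S i * sign R S j.
Proof. by move=> ij; rewrite big_setU1 ?inE //= big_set1. Qed.

(** Over ordered pairs the sum is the square of the total sign, minus [n]. *)
Lemma sum_sign_pairs S : - n%:R / 2 <= \sum_(e in pairs n) \prod_(i in e) sign R S i.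
Proof.
have := sum_pairs (fun e => \prod_(i in e) sign R S i).
rewrite (eq_bigr (fun i => (\sum_j sign R S j) * sign R S i - 1)); last first.
  move=> i _; rewrite [in RHS](bigD1 i) //= mulrDl.
  have -> : sign R S i * sign R S i = 1 by rewrite /sign; case: ifP => _; ring.
  rewrite addrAC subrr add0r mulr_suml; apply: eq_bigr => j ji.
  by rewrite prod_sign 1?eq_sym // mulrC.
rewrite sumrB -mulr_sumr sumr_const card_ord -expr2 => h.
have := sqr_ge0 (\sum_j sign R S j); lra.
Qed.

(** Moving [delta * #|E|] to the other side leaves a sum of [s e + delta] over the present edges, so
    the exponential moment factors although [#|E|] is random. *)
Lemma cut_prob (p delta : R) S : 0 <= p <= 1 -> 0 < delta <= 1 ->
  prob (pairs n) p (fun E => edge_sum E (sign R S) <= - delta * #|E|%:R) <=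
  expR (p * (delta * n%:R / 32 - delta ^+ 2 * #|pairs n|%:R / 32)).
Proof.
move=> p01 /andP[d0 d1]; have /andP[p0 p1] := p01.
pose s (e : {set 'I_n}) : R := \prod_(i in e) sign R S i.
(* The minimizer of [8 * t ^ 2 - t * delta], with value [- delta ^ 2 / 32]. *)
pose t : R := delta / 16.
pose g (e : {set 'I_n}) (b : bool) : R := if b then expR (- t * (s e + delta)) else 1.
have t0 : 0 < t by rewrite /t; lra.
apply: (@le_trans _ _ (expect (pairs n) p (fun E => \prod_(e in pairs n) g e (e \in E)))).
  apply: markov_prob => // E EP.
    by rewrite prodr_ge0 // => e _; rewrite /g; case: ifP => // _; apply: expR_ge0.
  move=> Ecut; rewrite (bigID (mem E)) /= [X in _ * X]big1 ?mulr1; last first.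
    by move=> e /andP[_ /negbTE ->].
  have -> : \prod_(e in pairs n | e \in E) g e (e \in E) =
            \prod_(e in E) expR (- t * (s e + delta)).
    apply: congr_big => // e.
      by rewrite andb_idl //; apply: (subsetP EP).
    by move=> /andP[_ eE]; rewrite /g eE.
  rewrite -expR_sum -expR0 ler_expR -mulr_sumr big_split sumr_const /=.
  rewrite -/(edge_sum E (sign R S)) -[delta *+ _]mulr_natr; nra.
rewrite expect_prod.
apply: (@le_trans _ _ (\prod_(e in pairs n) expR (p * (expR (- t * (s e + delta)) - 1)))).
  apply: ler_prod => e _; rewrite /g addr_ge0 ?mulr_ge0 ?expR_ge0 ?subr_ge0 //=.
  by apply: le_trans (expR_ge1Dx _); lra.
rewrite -expR_sum ler_expR -mulr_sumr ler_wpM2l //.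
have s1 e : -1 <= s e <= 1.
  rewrite -ler_norml /s normr_prod big1 // => i _; rewrite /sign.
  by case: ifP => _; rewrite ?normrN normr1.
apply: (@le_trans _ _ (\sum_(e in pairs n) (- t * s e + (8 * t ^+ 2 - t * delta)))).
  apply: ler_sum => e _; have /andP[s1e s2e] := s1 e.
  have yb : - t * (s e + delta) <= 2^-1 by rewrite /t; nra.
  have := expR_le_quadratic yb.
  have : (s e + delta) ^+ 2 <= 4 by nra.
  have : 0 < t ^+ 2 by rewrite exprn_gt0.
  nra.
rewrite big_split /= sumr_const -mulr_sumr -[_ *+ #|_|]mulr_natr.
have := sum_sign_pairs S; rewrite -/(\sum_(e in pairs n) s e) => h.
have {}h : - t * \sum_(e in pairs n) s e <= t * (n%:R / 2) by nra.
apply: le_trans (lerD h (lexx _)) _.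
by rewrite /t le_eqVlt; apply/orP; left; apply/eqP; field.
Qed.

(** A vector [K]-coloring rounds to a set with edge sum at most [- delta * #|E|]; there are
    [2 ^ n <= expR n] candidate sets. *)
Lemma theta_half_lower_prob (K p delta : R) : 2 <= K -> 0 <= p <= 1 -> (2 <= n)%N ->
  delta = (K - 1)^-1 ^+ 3 / 32 ->
  prob (pairs n) p (fun E => theta (@half_kind R) E < K) <=
  expR (n%:R + p * (delta * n%:R / 32 - delta ^+ 2 * #|pairs n|%:R / 32)).
Proof.
move=> K2 p01 n2 dE.
have K1 : 0 < K - 1 by lra.
have a01 : 0 < (K - 1)^-1 <= 1 by rewrite invr_gt0 K1 invf_le1 //; lra.
have /andP[a0 a1] := a01.
have d01 : 0 < delta <= 1.
  have a3 : 0 < (K - 1)^-1 ^+ 3 by rewrite exprn_gt0.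
  have a31 : (K - 1)^-1 ^+ 3 <= 1 by rewrite exprn_ile1 // ltW.
  by rewrite dE; lra.
apply: (@le_trans _ _ (prob (pairs n) p (fun E => exists2 S, predT S &
    edge_sum E (sign R S) <= - delta * #|E|%:R))).
  apply: ler_prob => // E gE /(theta_lt_colorable n2 (@half_kind_admissible R))[k1].
  move=> /colorable_unit => /(_ k1)[v [v1 vP]].
  have [|S SE] := vectors_to_cut gE a01 v1; last by exists S; rewrite // dE.
  by move=> i j ij aij; apply/half_le => //; apply: vP.
apply: (le_trans (prob_exists_le _ p01 _ _)).
apply: (le_trans (ler_sum _ (fun S _ => cut_prob S p01 d01))).
rewrite sumr_const -[X in X <= _]mulr_natl expRD ler_wpM2r ?expR_ge0 //.
have -> : #|(predT : pred {set 'I_n})| = (2 ^ n)%N.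
  by rewrite -[LHS]cardsT -powersetT card_powerset cardsT card_ord.
rewrite natrX -[n%:R]mulr1 expRM_natl lerXn2r ?nnegrE ?expR_ge0 //.
by apply: le_trans (expR_ge1Dx 1); lra.
Qed.

End LowerBound.

Lemma theta_half_lower (R : realType) (K : R) : 2 <= K ->
  exists C : R, 0 < C /\ exists n0 : nat, forall (n : nat) (p : R),
    (n0 <= n)%N -> 0 <= p <= 1 -> C <= p * n%:R ->
    prob (pairs n) p (fun E => theta (@half_kind R) E < K) <= n%:R^-1.
Proof.
move=> K2; pose delta : R := (K - 1)^-1 ^+ 3 / 32.
have d0 : 0 < delta by rewrite divr_gt0 // exprn_gt0 // invr_gt0; lra.
have d2 : 0 < delta ^+ 2 by rewrite exprn_gt0.
(* Once [delta * n >= 8], the negative term absorbs the linear one and leaves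
   [p * n * delta ^ 2 * n / 256 >= 2 * n], so the exponent is at most [- n]. *)
exists (512 / delta ^+ 2); split; first by apply: (divr_gt0 _ d2); lra.
have [n1 n1P] : exists n1 : nat, 8 / delta <= n1%:R.
  exists (Num.bound (8 / delta)); apply/ltW/archi_boundP.
  by rewrite divr_ge0 // ltW.
exists (maxn 2 n1) => n p; rewrite geq_max => /andP[n2 n1n] p01 pn.
have n0 : 0 < n%:R :> R by rewrite ltr0n ltnW.
have {}n1P : 8 <= delta * n%:R.
  rewrite mulrC -ler_pdivrMr //; apply: le_trans n1P _; by rewrite ler_nat.
apply: le_trans (theta_half_lower_prob K2 p01 n2 (erefl delta)) _.
apply: (@le_trans _ _ (expR (- n%:R))).
  rewrite ler_expR.
  have cp := card_pairs R n.
  have nn2 : 2 <= n%:R :> R by rewrite ler_nat.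
  have pn512 : 512 <= p * n%:R * delta ^+ 2 by rewrite -ler_pdivrMr.
  have -> : delta ^+ 2 * #|pairs n|%:R / 32 = delta ^+ 2 * (n%:R * (n%:R - 1)) / 64.
    by rewrite -cp; field.
  set N := n%:R in n1P nn2 pn512 *.
  have : p * N * (delta ^+ 2 * (N - 1) / 64 - delta / 32) >= p * N * (delta ^+ 2 * N / 256).
    have /andP[p0 _] := p01.
    apply: ler_wpM2l; first by rewrite mulr_ge0 // ltW.
    nra.
  nra.
rewrite expRN lef_pV2 ?posrE ?expR_gt0 //.
by apply: le_trans (expR_ge1Dx _); lra.
Qed.

(** * Density of small vertex sets *)

Section FirstMoment.
Variable R : realType.

(** A weak Stirling bound, by induction from [(1 + 1 / m) ^ m <= expR 1 <= 4]. *)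
Lemma expn_fact_le (m : nat) : (m%:R ^+ m : R) <= 4 ^+ m * m`!%:R.
Proof.
elim: m => [|m IH]; first by rewrite !expr0 fact0 mulr1.
have [->|m0] := posnP m; first by rewrite !expr1 mulr1; lra.
have m0' : 0 < m%:R :> R by rewrite ltr0n.
have e4 : expR 1 <= 4 :> R.
  have h : 2^-1 <= 2^-1 :> R by [].
  have := expR_le_quadratic h; have := expR_gt0 (2^-1 : R).
  have -> : expR 1 = expR 2^-1 * expR 2^-1 :> R by rewrite -expRD; congr expR; lra.
  nra.
have : (1 + m%:R^-1) ^+ m <= 4 :> R.
  apply: le_trans e4; have -> : 1 = m%:R * m%:R^-1 :> R by rewrite mulfV // gt_eqF.
  rewrite expRM_natl mulfV ?gt_eqF //.
  by rewrite lerXn2r ?nnegrE ?expR_ge0 ?expR_ge1Dx // addr_ge0 // invr_ge0 ltW.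
have -> : 1 + m%:R^-1 = m.+1%:R / m%:R :> R.
  by rewrite -natr1 mulrDl mulfV ?gt_eqF // mul1r addrC.
rewrite expr_div_n ler_pdivrMr ?exprn_gt0 // => h.
rewrite exprS factS natrM exprS.
apply: (@le_trans _ _ (m.+1%:R * (4 * (4 ^+ m * m`!%:R)))); last by rewrite le_eqVlt; apply/orP; left; apply/eqP; ring.
rewrite ler_pM2l ?ltr0n //; apply: (le_trans h); rewrite ler_pM2l; lra.
Qed.

Lemma bin_le (N m : nat) : ('C(N, m)%:R : R) * m%:R ^+ m <= (4 * N%:R) ^+ m.
Proof.
apply: (@le_trans _ _ ('C(N, m)%:R * (4 ^+ m * m`!%:R))).
  by rewrite ler_wpM2l // expn_fact_le.
rewrite mulrCA; have -> : 'C(N, m)%:R * m`!%:R = (N ^_ m)%:R :> R by rewrite -natrM bin_ffact.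
rewrite exprMn ler_wpM2l ?exprn_ge0 //.
rewrite -natrX ler_nat; elim: m => // m IH.
by rewrite ffactnSr expnSr leq_mul // leq_subr.
Qed.

Lemma exists_subset_card (T : finType) (A : {set T}) (m : nat) : (m <= #|A|)%N ->
  exists F : {set T}, F \subset A /\ #|F| = m.
Proof.
move=> mA; have : (0 < 'C(#|A|, m))%N by rewrite bin_gt0.
rewrite -cards_draws card_gt0 => /set0Pn[F]; rewrite inE => /andP[FA /eqP Fm].
by exists F.
Qed.

Section Gnp.
Variables (n : nat) (p : R).
Hypothesis p01 : 0 <= p <= 1.

Lemma prob_subset_card (A : {set {set 'I_n}}) (m : nat) : A \subset pairs n ->
  prob (pairs n) p (fun E => exists2 F : {set {set 'I_n}},
     (F \subset A) && (#|F| == m) & F \subset E) <= 'C(#|A|, m)%:R * p ^+ m.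
Proof.
move=> AP; apply: (le_trans (prob_exists_le _ p01 _ _)).
rewrite (eq_bigr (fun=> p ^+ m)) => [|F /andP[FA /eqP Fm]].
  by rewrite sumr_const -cards_draws mulr_natl cardsE.
by rewrite prob_sub ?Fm // (subset_trans FA).
Qed.

Lemma sum_pow_le (x : R) (N : nat) : 0 <= x -> x <= 2^-1 ->
  \sum_(s < N) x ^+ s.+1 <= 2 * x.
Proof.
move=> x0 x2.
suff : \sum_(s < N) x ^+ s.+1 <= 2 * x * (1 - x ^+ N).
  by move/le_trans; apply; have := exprn_ge0 N x0; nra.
elim: N => [|N IH]; first by rewrite big_ord0 expr0; lra.
rewrite big_ord_recr /= exprS; have q0 := exprn_ge0 N x0.
have x12 : 0 <= 1 - 2 * x by lra.
have := mulr_ge0 (mulr_ge0 x0 q0) x12; lra.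
Qed.

(** Union bound over [S] of size [s] and over sets of [k.+1 * s] inner edges. The number of choices
    of [S] times the bound for one [S] is at most the [s]-th power of
    [4 ^ k.+2 * n * s ^ k * p ^ k.+1], hence at most [x ^ s], and the sum over [s] is geometric. *)
Lemma prob_not_sparse (k : nat) (lam : R) : 0 <= lam ->
  let x := 4 ^+ k.+2 * n%:R * lam ^+ k * p ^+ k.+1 in
  x <= 2^-1 -> prob (pairs n) p (fun E => ~ sparse E k.+1 lam) <= 2 * x.
Proof.
move=> lam0 x x2; have /andP[p0 p1] := p01.
have c0 : 0 <= 4 ^+ k.+2 * n%:R :> R by rewrite mulr_ge0 //; apply: exprn_ge0.
have x0 : 0 <= x by exact: mulr_ge0 (mulr_ge0 c0 (exprn_ge0 _ lam0)) (exprn_ge0 _ p0).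
pose B (S : {set 'I_n}) := [set e in pairs n | e \subset S].
pose ok (S : {set 'I_n}) := (S != set0) && (#|S|%:R <= lam).
have cB S : #|B S| = 'C(#|S|, 2).
  rewrite -cards_draws; apply: eq_card => e; rewrite !inE andbC.
  by [].
apply: (@le_trans _ _ (\sum_(S : {set 'I_n} | ok S) x ^+ #|S| / 'C(n, #|S|)%:R)).
  apply: (@le_trans _ _ (prob (pairs n) p (fun E => exists2 S, ok S &
    exists2 F : {set {set 'I_n}}, (F \subset B S) && (#|F| == k.+1 * #|S|)%N & F \subset E))).
    apply: ler_prob => // E gE; rewrite /sparse => /existsNP[S] /not_implyP[S0] /not_implyP[Sl].
    move/negP; rewrite -leqNgt => /exists_subset_card[F [FE Fc]].
    exists S; first by rewrite /ok S0.
    exists F.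
      rewrite Fc eqxx andbT (subset_trans FE) //; apply/subsetP => e; rewrite !inE.
      by move=> /andP[/(subsetP gE) + ->]; rewrite inE => ->.
    by apply: (subset_trans FE); apply/subsetP => e; rewrite inE => /andP[].
  apply: (le_trans (prob_exists_le _ p01 _ _)); apply: ler_sum => S /andP[S0 Sl].
  have BP : B S \subset pairs n by apply/subsetP => e; rewrite inE => /andP[].
  apply: (le_trans (prob_subset_card _ BP)); rewrite cB.
  set s := #|S| in Sl *.
  have s0 : (0 < s)%N by rewrite card_gt0.
  have s0' : 0 < s%:R :> R by rewrite ltr0n.
  have sn : (s <= n)%N by rewrite -[X in (_ <= X)%N]card_ord max_card.
  have C0 : 0 < 'C(n, s)%:R :> R by rewrite ltr0n bin_gt0.
  rewrite ler_pdivlMr //.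
  have h1 := bin_le n s; have h2 := bin_le 'C(s, 2) (k.+1 * s).
  have h3 : (4 * 'C(s, 2)%:R : R) <= 4 * (s%:R * s%:R).
    rewrite ler_pM2l; last lra.
    by rewrite -natrM ler_nat bin2 -divn2 (leq_trans (leq_div _ _)) // leq_mul2l leq_pred orbT.
  set m := (k.+1 * s)%N in h2 *.
  have m1 : s%:R ^+ m <= m%:R ^+ m :> R.
    by rewrite lerXn2r ?nnegrE // ler_nat leq_pmull.
  have h2' : ('C('C(s, 2), m)%:R : R) <= (4 * s%:R) ^+ m.
    rewrite -(ler_pM2r (exprn_gt0 m s0')) -exprMn -mulrA.
    apply: (le_trans _ (le_trans h2 _)); first by rewrite ler_wpM2l.
    by rewrite lerXn2r ?nnegrE ?mulr_ge0.
  have h1' : ('C(n, s)%:R : R) <= (4 * n%:R / s%:R) ^+ s.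
    by rewrite expr_div_n ler_pdivlMr ?exprn_gt0.
  apply: (@le_trans _ _ ((4 * s%:R) ^+ m * p ^+ m * (4 * n%:R / s%:R) ^+ s)).
    apply: ler_pM => //; first by rewrite mulr_ge0 ?exprn_ge0.
    by rewrite ler_wpM2r ?exprn_ge0.
  rewrite -exprMn exprM -exprMn lerXn2r ?nnegrE //.
    by rewrite !(mulr_ge0, exprn_ge0, invr_ge0).
  have -> : (4 * s%:R * p) ^+ k.+1 * (4 * n%:R / s%:R) =
     4 ^+ k.+2 * n%:R * s%:R ^+ k * p ^+ k.+1.
    by rewrite !exprMn !exprS; field; rewrite gt_eqF.
  rewrite /x; apply: ler_wpM2r; first exact: exprn_ge0.
  apply: ler_wpM2l => //.
  by rewrite lerXn2r ?nnegrE.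
(* Grouping the sets by size cancels the binomial coefficient; the empty set must contribute 0
   rather than [x ^ 0]. *)
pose G (s : nat) : R := if s == 0%N then 0 else x ^+ s.
apply: (@le_trans _ _ (\sum_(S : {set 'I_n}) G #|S| / 'C(n, #|S|)%:R)).
  rewrite big_mkcond; apply: ler_sum => S _; rewrite /ok /G cards_eq0.
  case: eqP => _ /=; first by rewrite mul0r.
  by case: ifP => // _; rewrite mulr_ge0 ?exprn_ge0 ?invr_ge0.
rewrite (partition_big (fun S : {set 'I_n} => inord #|S| : 'I_n.+1) xpredT) //=.
have cn (S : {set 'I_n}) : (#|S| < n.+1)%N by rewrite ltnS -[X in (_ <= X)%N]card_ord max_card.
rewrite (eq_bigr (fun s : 'I_n.+1 => G s)) => [|s _]; last first.
  rewrite (eq_bigl (fun S : {set 'I_n} => S \in [set S : {set 'I_n} | #|S| == s])); last first.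
    by move=> S; rewrite inE -val_eqE /= inordK.
  rewrite (eq_bigr (fun=> G s / 'C(n, s)%:R)) => [|S]; last by rewrite inE => /eqP ->.
  rewrite sumr_const card_draws card_ord -[_ *+ _]mulr_natr divfK //.
  by rewrite pnatr_eq0 -lt0n bin_gt0 -ltnS.
rewrite big_ord_recl /= add0r.
exact: sum_pow_le.
Qed.

Lemma card_star (v : 'I_n) : (#|star v| <= n)%N.
Proof.
apply: (@leq_trans #|[set [set v; w] | w in [set: 'I_n]]|).
  apply/subset_leq_card/subsetP => e; rewrite !inE => /andP[/cards2P[a [b [ab ->]]]].
  rewrite !inE => /orP[] /eqP ->; apply/imsetP; [exists b | exists a] => //.
  by rewrite setUC.
by apply: (leq_trans (leq_imset_card _ _)); rewrite cardsT card_ord.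
Qed.

Lemma prob_degree (lam : R) (t0 : nat) : 1 <= lam -> t0%:R <= lam ->
  4 * n%:R * p / lam <= 1 ->
  prob (pairs n) p (fun E => exists2 v : 'I_n, true & 2 * lam < #|nbrs E v|%:R) <=
  n%:R * (4 * n%:R * p / lam) ^+ t0.
Proof.
move=> lam1 t0l base1; have /andP[p0 p1] := p01.
have lam0 : 0 < lam by lra.
(* A degree above [2 * lam] contains [t] edges of the star, and [lam >= 1] keeps [t >= lam] after
   rounding down. *)
pose t := Num.truncn (2 * lam).
have /andP[t2 tlt] : t%:R <= 2 * lam < t.+1%:R by apply: Num.Theory.truncn_itv; lra.
have lt : lam <= t%:R by move: tlt; rewrite -natr1; lra.
have t0t : (t0 <= t)%N by rewrite -(ler_nat R); lra.
have tR0 : 0 < t%:R :> R by lra.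
apply: (le_trans (prob_exists_le _ p01 _ _)).
set y := _ ^+ t0; have -> : n%:R * y = \sum_(v < n) y by rewrite sumr_const card_ord mulr_natl.
rewrite {}/y; apply: ler_sum => v _.
apply: (@le_trans _ _ ('C(#|star v|, t)%:R * p ^+ t)).
  apply: le_trans (prob_subset_card t (_ : star v \subset pairs n)); last first.
    by apply/subsetP => e; rewrite inE => /andP[].
  apply: ler_prob => // E gE degv.
  pose A := [set [set v; w] | w in nbrs E v].
  have AE : A \subset E.
    by apply/subsetP => e /imsetP[w]; rewrite inE => /andP[_ avw] ->.
  have cA : #|A| = #|nbrs E v|.
    apply: card_in_imset => v1 v2; rewrite !inE => /andP[v1w _] _ /setP/(_ v1).
    by rewrite !inE eqxx orbT (negbTE v1w) /= => /esym/eqP.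
  have tA : (t <= #|A|)%N.
    by rewrite cA ltnW // -(ltr_nat R); lra.
  have [F [FA Fc]] := exists_subset_card tA.
  exists F; last exact: subset_trans AE.
  rewrite Fc eqxx andbT; apply: (subset_trans FA); apply/subsetP => e eA.
  rewrite inE (subsetP gE) ?(subsetP AE) //=.
  by case/imsetP: eA => w _ ->; rewrite set21.
apply: (@le_trans _ _ ((4 * n%:R * p / lam) ^+ t)); last first.
  by rewrite ler_wiXn2l // !mulr_ge0 ?invr_ge0 // ltW.
have -> : 4 * n%:R * p / lam = 4 * n%:R / lam * p by rewrite mulrAC.
rewrite exprMn ler_wpM2r ?exprn_ge0 // expr_div_n ler_pdivlMr ?exprn_gt0 //.
have h := bin_le #|star v| t.
apply: (@le_trans _ _ ('C(#|star v|, t)%:R * t%:R ^+ t)).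
  by rewrite ler_wpM2l // lerXn2r ?nnegrE // ltW.
apply: (le_trans h); rewrite lerXn2r ?nnegrE ?mulr_ge0 // ler_wpM2l //.
by rewrite ler_nat card_star.
Qed.

End Gnp.
End FirstMoment.

(** * Asymptotics *)

Section Asymptotics.
Variable R : realType.

Lemma powR_small (g e : R) : 0 < g -> 0 < e ->
  exists n0 : nat, forall n, (n0 <= n)%N -> n%:R `^ (- g) <= e.
Proof.
move=> g0 e0; exists (Num.bound (e^-1 `^ g^-1)) => n n0n.
have b0 : 0 <= e^-1 `^ g^-1 by apply: powR_ge0.
have nb : e^-1 `^ g^-1 <= n%:R.
  by apply: (le_trans (ltW (archi_boundP b0))); rewrite ler_nat.
have : (e^-1 `^ g^-1) `^ g <= n%:R `^ g by apply: ge0_ler_powR; rewrite ?nnegrE // ltW.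
rewrite -powRrM mulVf ?gt_eqF // powRr1 ?invr_ge0 ?(ltW e0) // => h.
by rewrite powRN -[e]invrK lef_pV2 // posrE ?invr_gt0 //; apply: lt_le_trans h; rewrite invr_gt0.
Qed.

(** Collects the errors: [8 * h] from quantile and defect, [2 * M * h] from sparsity, [M * h] from
    degrees. *)
Lemma concentration_at (n k t0 : nat) (p lam h M : R) (P : bool -> R -> Prop) :
  admissible P -> (forall z, P true z -> z <= 0) ->
  (2 <= n)%N -> 0 <= p <= 1 -> 1 <= lam -> 4 * n%:R / lam ^+ 2 <= 4 * h -> 4 * h <= 1 ->
  prob (pairs n) p (fun E => theta (@half_kind R) E < (2 * k.+1 + 4 * k.+1 * k.+1)%:R) <
    4 * n%:R / lam ^+ 2 ->
  4 ^+ k.+2 * n%:R * (2 * lam) ^+ k * p ^+ k.+1 <= M * h -> M * h <= 2^-1 ->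
  t0%:R <= lam -> 4 * n%:R * p / lam <= 1 ->
  n%:R * (4 * n%:R * p / lam) ^+ t0 <= M * h ->
  exists u : R, prob (pairs n) p (fun E => ~ (u <= theta P E /\ theta P E <= u + 2)) <=
    (8 + 3 * M) * h.
Proof.
move=> PA PH n2 p01 lam1 eps4 h4 low xM M2 t0l base1 degM.
have [u uP] := theta_concentration PA PH n2 p01 lam1 (ltn0Sn k) (le_trans eps4 h4) low.
exists u; apply: (le_trans uP).
have lam2 : 0 <= 2 * lam by lra.
have sp := prob_not_sparse p01 lam2 (le_trans xM M2).
have dg := prob_degree p01 lam1 t0l base1.
lra.
Qed.

Lemma concentration_rate : exists c0 : R, 0 < c0 /\
  forall beta : R, 1 / 2 < beta -> beta < 1 ->
  exists g C : R, 0 < g /\ 0 <= C /\ exists n0 : nat, forall (n : nat) (p : R), (n0 <= n)%N ->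
    c0 / n%:R <= p -> p <= n%:R `^ (- beta) ->
    0 <= p <= 1 /\ (2 <= n)%N /\
    forall P, admissible P -> (forall z, P true z -> z <= 0) ->
    exists u : R, prob (pairs n) p (fun E => ~ (u <= theta P E /\ theta P E <= u + 2)) <=
      C * n%:R `^ (- g).
Proof.
(* The threshold for [r = 2], fixed before [beta] so that [c0] is absolute. *)
have [|CB [CB0 [nB lowB]]] := @theta_half_lower R (2 * 2 + 4 * 2 * 2)%:R.
  by rewrite ler_nat.
exists CB; split=> // beta beta1 beta2.
(* Thus [beta = 1 / 2 + 2 * g]: with [lam = n ^ (1 / 2 + g)] the ratio [n * p / lam] is at most
   [n ^ (- 3 * g)]. *)
pose g : R := (beta - 1 / 2) / 2.
have g0 : 0 < g by rewrite /g; lra.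
have g4 : g < 1 / 4 by rewrite /g; lra.
pose k := Num.bound g^-1.
have kg : 1 <= k%:R * g.
  rewrite -ler_pdivrMr // div1r; apply/ltW/archi_boundP; by rewrite invr_ge0 ltW.
have [|CA [CA0 [nA lowA]]] := @theta_half_lower R (2 * k.+1 + 4 * k.+1 * k.+1)%:R.
  by rewrite ler_nat; nia.
(* One summand for each error bound: sparsity with [r = k.+1], sparsity with [r = 2], and
   degrees. *)
pose M : R := 4 ^+ k.+2 * 2 ^+ k + 128 * CA ^+ 2 + 4 ^+ k.
have M4 : 0 <= 4 ^+ k :> R by apply: exprn_ge0.
have MA : 0 <= 4 ^+ k.+2 * 2 ^+ k :> R by apply: mulr_ge0; apply: exprn_ge0.
have MB : 0 <= 128 * CA ^+ 2 by have := sqr_ge0 CA; lra.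
have M0 : 0 <= M by rewrite /M; lra.
have [e [e0 [e4 [eM ek]]]] : exists e : R, 0 < e /\ 4 * e <= 1 /\ M * e <= 2^-1 /\ k%:R * e <= 1.
  exists (4 + 2 * M + k%:R)^-1; have k0 : 0 <= k%:R :> R by [].
  have d0 : 0 < 4 + 2 * M + k%:R by lra.
  rewrite invr_gt0 d0; split=> //.
  by rewrite !ler_pdivrMr //; split; [lra|split; lra].
have [n1 small] := powR_small g0 e0.
exists g, (8 + 3 * M); split=> //; split; first lra.
exists (maxn 2 (maxn nA (maxn nB n1))) => n p.
rewrite !geq_max => /and4P[n2 nnA nnB nn1] pl pu.
have n0 : 0 < n%:R :> R by rewrite ltr0n ltnW.
have nn : 1 <= n%:R :> R by rewrite ler1n ltnW.
have p0 : 0 <= p by apply: le_trans pl; rewrite divr_ge0 // ltW.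
have pw_le a b : a <= b -> n%:R `^ a <= n%:R `^ b :> R by exact: ler_powR.
have p1 : p <= 1.
  by apply: (le_trans pu); rewrite -[leRHS](powRr0 (n%:R : R)); apply: pw_le; lra.
have p01 : 0 <= p <= 1 by rewrite p0.
split=> //; split=> // P PA PH.
have pwD a b : n%:R `^ (a + b) = n%:R `^ a * n%:R `^ b :> R.
  by apply: powRD; rewrite (gt_eqF n0) implybT.
have pwX a m : (n%:R `^ a) ^+ m = n%:R `^ (a * m%:R) :> R.
  by rewrite powRrM powR_mulrn ?powR_ge0.
have pw1 : n%:R = n%:R `^ 1 :> R by rewrite powRr1.
pose h : R := n%:R `^ (- g).
have h0 : 0 < h by apply: powR_gt0.
have he : h <= e by exact: small.
pose lam : R := n%:R `^ (1 / 2 + g).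
have lam0 : 0 < lam by apply: powR_gt0.
have lam1 : 1 <= lam by rewrite -[leLHS](powRr0 (n%:R : R)); apply: pw_le; lra.
have epsE : 4 * n%:R / lam ^+ 2 = 4 * n%:R `^ (- (2 * g)).
  rewrite pwX -powRN -mulrA {1}pw1 -pwD; congr (_ * _ `^ _); lra.
have eps4 : 4 * n%:R / lam ^+ 2 <= 4 * h.
  by rewrite epsE ler_pM2l //; apply: pw_le; lra.
have low K : prob (pairs n) p (fun E => theta (@half_kind R) E < K) <= n%:R^-1 ->
    prob (pairs n) p (fun E => theta (@half_kind R) E < K) < 4 * n%:R / lam ^+ 2.
  move=> pK; rewrite epsE; apply: (le_lt_trans pK).
  rewrite -(powR_inv1 (ltW n0)).
  have := powR_gt0 (- (2 * g)) n0; have : n%:R `^ (-1) <= n%:R `^ (- (2 * g)) :> R.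
    by apply: pw_le; lra.
  lra.
have t0l : k%:R <= lam.
  have : n%:R `^ g <= lam by apply: pw_le; lra.
  apply: le_trans; have hg : h * n%:R `^ g = 1 by rewrite -pwD addNr powRr0.
  have kh : k%:R * h <= 1 by apply: le_trans ek; rewrite ler_wpM2l.
  have -> : k%:R = k%:R * h * n%:R `^ g :> R by rewrite -mulrA hg mulr1.
  by rewrite ler_piMl // powR_ge0.
have bE : beta = 1 / 2 + 2 * g by rewrite /g; field.
have base : 4 * n%:R * p / lam <= 4 * n%:R `^ (- (3 * g)).
  apply: (@le_trans _ _ (4 * n%:R * n%:R `^ (- beta) / lam)).
    by rewrite ler_pM2r ?invr_gt0 // ler_pM2l // mulr_gt0.
  rewrite -powRN -!mulrA {1}pw1 -!pwD le_eqVlt; apply/orP; left; apply/eqP.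
  congr (_ * _ `^ _); lra.
have base0 : 0 <= 4 * n%:R * p / lam.
  by apply: mulr_ge0; [apply: mulr_ge0 => //; apply: mulr_ge0 | rewrite invr_ge0 ltW].
have base1 : 4 * n%:R * p / lam <= 1.
  have : n%:R `^ (- (3 * g)) <= h by apply: pw_le; lra.
  lra.
have deg : n%:R * (4 * n%:R * p / lam) ^+ k <= M * h.
  apply: (@le_trans _ _ (n%:R * (4 * n%:R `^ (- (3 * g))) ^+ k)).
    by rewrite ler_pM2l // lerXn2r ?nnegrE // mulr_ge0 // powR_ge0.
  rewrite exprMn pwX mulrCA {1}pw1 -pwD.
  apply: (@le_trans _ _ (4 ^+ k * h)); last by rewrite ler_pM2r // /M; lra.
  by rewrite ler_wpM2l //; apply: pw_le; lra.
have Mh : M * h <= 2^-1 by apply: le_trans eM; rewrite ler_wpM2l.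
have h4 : 4 * h <= 1 by lra.
(* In the dense case [r = k.+1] works, since [k * g >= 1] makes the sparsity exponent at most [- g].
   Below [CA] the factor [(p * n) ^ 2] is bounded and [r = 2] leaves only [lam / n]. *)
have [npA|npB] := leP CA (p * n%:R).
  apply: (@concentration_at n k k p lam h M) => //; first exact/low/lowA.
  apply: (@le_trans _ _ (4 ^+ k.+2 * 2 ^+ k * h)); last by rewrite ler_pM2r // /M; lra.
  have -> : 4 ^+ k.+2 * n%:R * (2 * lam) ^+ k * p ^+ k.+1 =
     4 ^+ k.+2 * 2 ^+ k * (n%:R * lam ^+ k * p ^+ k.+1) by rewrite exprMn; ring.
  rewrite ler_wpM2l //.
  apply: (@le_trans _ _ (n%:R * lam ^+ k * (n%:R `^ (- beta)) ^+ k.+1)).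
    by rewrite ler_wpM2l ?mulr_ge0 ?exprn_ge0 // ?(ltW lam0) // lerXn2r ?nnegrE // powR_ge0.
  rewrite !pwX {1}pw1 -!pwD; apply: pw_le; rewrite bE -(natr1 k); lra.
apply: (@concentration_at n 1 k p lam h M) => //.
  by apply/low/lowB => //; rewrite -ler_pdivrMr.
apply: (@le_trans _ _ (128 * CA ^+ 2 * h)); last by rewrite ler_pM2r // /M; lra.
have -> : 4 ^+ 3 * n%:R * (2 * lam) ^+ 1 * p ^+ 2 =
   128 * ((p * n%:R) ^+ 2 * (lam / n%:R)) by field; rewrite gt_eqF.
rewrite -mulrA ler_pM2l; last lra.
apply: ler_pM; rewrite ?sqr_ge0 ?divr_ge0 ?(ltW lam0) ?(ltW n0) //.
  by rewrite lerXn2r ?nnegrE ?mulr_ge0 // ltW.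
rewrite -(powR_inv1 (ltW n0)) -pwD; apply: pw_le; lra.
Qed.

End Asymptotics.

(** * Transfer to the random graph and passage to the limit *)

Lemma Gnp_probE (R : realType) (n : nat) (p : R) (Q : {set {set 'I_n}} -> Prop) :
  Gnp_prob p Q = prob (pairs n) p Q.
Proof.
rewrite /Gnp_prob /prob /expect big_mkcondr; apply: eq_bigr => E _.
by case: asboolP => _; rewrite ?mulr1 ?mulr0.
Qed.

Local Open Scope classical_set_scope.
Local Open Scope ring_scope.

Theorem theorem2 (R : realType) :
  exists c0 : R, 0 < c0 /\
  forall (beta : R), 1 / 2 < beta -> beta < 1 ->
  forall p : nat -> R,
    (\forall n \near \oo,
       c0 / n%:R <= p n /\ p n <= n%:R `^ (- beta)) ->
  exists s u u' u'' : nat -> R,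
    s @ \oo --> (2 / (2 * beta - 1) : R) /\
    (fun n : nat => @Gnp_prob R n (p n) (fun E =>
        (u n <= theta_half E /\ theta_half E <= u n + s n) /\
        (u' n <= theta_bar E /\ theta_bar E <= u' n + s n) /\
        (u'' n <= theta_two E /\ theta_two E <= u'' n + s n))) @ \oo --> (1 : R).
Proof.
have [c0 [c00 rate]] := concentration_rate R.
exists c0; split=> // beta beta1 beta2 p pP.
have [g [C [g0 [C0 [n0 conc]]]]] := rate beta beta1 beta2.
have s2 : 2 <= 2 / (2 * beta - 1) by rewrite ler_pdivlMr; lra.
pose bad P n (u : R) := prob (pairs n) (p n)
  (fun E => ~ (u <= theta P E /\ theta P E <= u + 2)).
pose ok n := [/\ (n0 <= n)%N, c0 / n%:R <= p n & p n <= n%:R `^ (- beta)].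
have U P : admissible P -> (forall z, P true z -> z <= 0) ->
    exists u : nat -> R, forall n, ok n -> bad P n (u n) <= C * n%:R `^ (- g).
  move=> PA PH; suff /choice[u uP] : forall n, exists u, ok n -> bad P n u <= C * n%:R `^ (- g).
    by exists u.
  move=> n; have [[n0n pl pu]|nok] := pselect (ok n); last by exists 0.
  have [_ [_ /(_ P PA PH)[u uP]]] := conc n (p n) n0n pl pu.
  by exists u.
have [u uP] := U _ (@half_kind_admissible R) (fun z h => h isT).
have [u' uP'] : exists u : nat -> R, forall n,
    ok n -> bad (@strict_kind R) n (u n) <= C * n%:R `^ (- g).
  by apply: U; [exact: strict_kind_admissible | move=> z ->].
have [u'' uP''] : exists u : nat -> R, forall n,
    ok n -> bad (@rigid_kind R) n (u n) <= C * n%:R `^ (- g).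
  by apply: U; [exact: rigid_kind_admissible | move=> z /= ->].
(* The width is constant, so its error term is 0; it is at least 2 because [beta < 1]. *)
exists (fun=> 2 / (2 * beta - 1)), u, u', u''; split; first exact: cvg_cst.
have nok : \forall n \near \oo, ok n.
  near=> n; have [pl pu] : c0 / n%:R <= p n /\ p n <= n%:R `^ (- beta) by near: n.
  by split=> //; near: n; exact: nbhs_infty_ge.
have h0 : (fun n => n%:R `^ (- g) : R) @ \oo --> (0 : R).
  apply/cvgrPdist_le => e e0; have [n1 small] := powR_small g0 e0.
  near=> n; rewrite sub0r normrN ger0_norm ?powR_ge0 //; apply: small.
  by near: n; exact: nbhs_infty_ge.
(* Each of the three intervals fails with probability at most [C * n ^ (- g)]. *)
apply: (@squeeze_cvgr _ _ _ _ (fun n => 1 - 3 * C * n%:R `^ (- g)) (fun=> 1)).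
- apply: filterS nok => n okn; rewrite Gnp_probE.
  have [n0n pl pu] := okn.
  have [p01 [n2 _]] := conc n (p n) n0n pl pu.
  rewrite prob_le1 // andbT.
  set Q := fun E => _.
  have : prob (pairs n) (p n) (fun E => ~ Q E) <=
      bad (@half_kind R) n (u n) + (bad (@strict_kind R) n (u' n) + bad (@rigid_kind R) n (u'' n)).
    apply: le_trans (lerD (lexx _) (prob_or _ p01 _ _)).
    apply: le_trans (prob_or _ p01 _ _).
    apply: ler_prob => // E _; rewrite /Q theta_halfE theta_barE theta_twoE.
    move=> /not_andP[H|/not_andP[H|H]]; [left|right; left|right; right];
      move=> [h1 h2]; apply: H; split=> //; apply: (le_trans h2); lra.
  rewrite prob_not //; have := uP n okn; have := uP' n okn; have := uP'' n okn; lra.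
- rewrite -[X in _ --> X]subr0 -(mulr0 (3 * C)).
  by apply: cvgB; [exact: cvg_cst | apply: cvgM; [exact: cvg_cst | exact: h0]].
- exact: cvg_cst.
Unshelve. all: by end_near.
Qed.
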